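(* Every infinitely edge-connected graph contains either the Farey graph or $T_{\aleph_0} * t$ as a minor.
   Context: Graphs are simple and may be infinite (of any cardinality). A graph $G$ is infinitely edge-connected if for every two distinct vertices $x,y$ of $G$ there is no finite set of edges whose deletion separates $x$ from $y$ (equivalently, there are infinitely many pairwise edge-disjoint $x$–$y$ paths). A graph $H$ is a minor of $G$ if $H$ can be obtained from a subgraph of $G$ by contracting disjoint connected (possibly infinite) induced subgraphs; equivalently, there are disjoint non-empty vertex sets $V_h\subseteq V(G)$ ($h\in V(H)$), each inducing a connected subgraph of $G$, such that $G$ has a $V_h$–$V_{h'}$ edge whenever $hh'\in E(H)$. The Farey graph $F$ is the graph on $\mathbb{Q}\cup\{\infty\}$ in which two rationals $a/b$ and $c/d$ in lowest terms (with $\infty=(\pm1)/0$) are adjacent if and only if $ad-bc=\pm 1$. $T_{\aleph_0}$ denotes the tree in which every vertex has countably infinite degree, and $T_{\aleph_0}*t$ is the graph obtained from $T_{\aleph_0}$ by adding a new vertex $t$ adjacent to all vertices of $T_{\aleph_0}$. *)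

(* Defs.v *)
From HB Require Import structures.
From mathcomp Require Import all_boot all_order all_algebra.
From mathcomp Require Import boolp classical_sets functions cardinality.

Set Implicit Arguments.
Unset Strict Implicit.
Unset Printing Implicit Defensive.

Local Open Scope classical_set_scope.

Record sgraph := SGraph {
  vertex :> Type;
  adj : rel vertex;
  adj_sym : symmetric adj;
  adj_irr : irreflexive adj }.

Definition neighbors (G : sgraph) (x : G) : set G := [set y | adj x y].

Definition edges (G : sgraph) : set (set G) :=
  [set e | exists x y : G, adj x y /\ e = [set x; y]].

Definition linked (G : sgraph) (x y : G) :=
  exists p : seq G, path (@adj G) x p /\ last x p = y.

(* The graph without vertices is connected in this sense. *)
Definition connected (G : sgraph) := forall x y : G, linked x y.

Definition induced_adj (G : sgraph) (U : set G) : rel (set_type U) :=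
  fun u v => adj (sval u) (sval v).

Lemma induced_adj_sym (G : sgraph) (U : set G) : symmetric (@induced_adj G U).
Proof. by move=> u v; apply: adj_sym. Qed.

Lemma induced_adj_irr (G : sgraph) (U : set G) : irreflexive (@induced_adj G U).
Proof. by move=> u; apply: adj_irr. Qed.

Definition induced (G : sgraph) (U : set G) : sgraph :=
  SGraph (@induced_adj_sym G U) (@induced_adj_irr G U).

Definition del_adj (G : sgraph) (F : set (set G)) : rel G :=
  fun x y => adj x y && ([set x; y] \notin F).

Lemma del_adj_sym (G : sgraph) (F : set (set G)) : symmetric (del_adj F).
Proof. by move=> x y; rewrite /del_adj adj_sym setUC. Qed.

Lemma del_adj_irr (G : sgraph) (F : set (set G)) : irreflexive (del_adj F).
Proof. by move=> x; rewrite /del_adj adj_irr. Qed.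

Definition del_edges (G : sgraph) (F : set (set G)) : sgraph :=
  SGraph (del_adj_sym F) (del_adj_irr F).

Definition separates (G : sgraph) (F : set (set G)) (x y : G) :=
  ~ @linked (del_edges F) x y.

(* As usual for edge-connectivity, graphs with at most one vertex are
   excluded. *)
Definition infinitely_edge_connected (G : sgraph) :=
  (exists x y : G, x <> y) /\
  forall x y : G, x <> y ->
    ~ exists F : set (set G),
        [/\ F `<=` @edges G, finite_set F & separates F x y].

Definition minor (H G : sgraph) :=
  exists V : H -> set G,
    [/\ forall h, V h !=set0,
        forall h, connected (induced (V h)),
        forall h h', h <> h' -> V h `&` V h' = set0
      & forall h h', adj h h' ->
          exists x y : G, [/\ V h x, V h' y & adj x y] ].

Section Farey.
Local Open Scope ring_scope.

(* None is the vertex oo = 1/0. *)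
Definition farey_num (x : option rat) : int :=
  if x is Some q then numq q else 1.
Definition farey_den (x : option rat) : int :=
  if x is Some q then denq q else 0.

Definition farey_det (x y : option rat) : int :=
  farey_num x * farey_den y - farey_num y * farey_den x.

Definition farey_adj : rel (option rat) :=
  fun x y => (farey_det x y == 1) || (farey_det x y == -1).

Lemma farey_adj_sym : symmetric farey_adj.
Proof.
move=> x y; rewrite /farey_adj.
have -> : farey_det x y = - farey_det y x by rewrite /farey_det GRing.opprB.
by rewrite GRing.eqr_oppLR GRing.eqr_opp orbC.
Qed.

Lemma farey_adj_irr : irreflexive farey_adj.
Proof. by move=> x; rewrite /farey_adj /farey_det GRing.subrr. Qed.

Definition farey : sgraph := SGraph farey_adj_sym farey_adj_irr.

End Farey.

Definition apex_adj (G : sgraph) : rel (option G) :=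
  fun x y => match x, y with
             | Some u, Some v => adj u v
             | None, None => false
             | _, _ => true
             end.

Lemma apex_adj_sym (G : sgraph) : symmetric (@apex_adj G).
Proof. by move=> [u|] [v|] //=; apply: adj_sym. Qed.

Lemma apex_adj_irr (G : sgraph) : irreflexive (@apex_adj G).
Proof. by move=> [u|] //=; apply: adj_irr. Qed.

(* The graph G * t, where None is the new vertex t. *)
Definition add_apex (G : sgraph) : sgraph :=
  SGraph (@apex_adj_sym G) (@apex_adj_irr G).

Definition acyclic (G : sgraph) :=
  ~ exists c : seq G,
      [/\ 2 < size c, cycle (@adj G) c & @uniq {classic G} c].

Definition is_tree (G : sgraph) :=
  [/\ inhabited G, connected G & acyclic G].

(* Determines T up to isomorphism; exists_T_aleph0 gives existence. *)
Definition is_T_aleph0 (T : sgraph) :=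
  is_tree T /\ forall x : T, (neighbors x #= [set: nat])%card.

Section Existence.

(* Finite sequences of naturals, the parent of n :: s being s. *)
Definition seqtree_adj : rel (seq nat) :=
  fun s t => ((s != [::]) && (behead s == t)) || ((t != [::]) && (behead t == s)).

Lemma seqtree_adj_sym : symmetric seqtree_adj.
Proof. by move=> s t; rewrite /seqtree_adj orbC. Qed.

Lemma seqtree_adj_irr : irreflexive seqtree_adj.
Proof.
move=> [|n s] //; rewrite /seqtree_adj /= orbb.
by apply/negbTE/eqP => /(congr1 size) /= /n_Sn.
Qed.

Definition seqtree : sgraph := SGraph seqtree_adj_sym seqtree_adj_irr.

Lemma seqtree_adj_behead (s t : seq nat) :
  seqtree_adj s t -> size t <= size s -> t = behead s.
Proof.
case/orP => /andP [ne /eqP <-] //.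
by case: t ne => //= n t _; rewrite ltnn.
Qed.

Lemma seqtree_connected : connected seqtree.
Proof.
have down (s : seq nat) : exists p, path seqtree_adj s p /\ last s p = [::].
  elim: s => [|n s [p [ps lp]]]; first by exists [::].
  by exists (s :: p); split=> //=; rewrite ps {1}/seqtree_adj /= eqxx.
move=> s t; have [p [ps lp]] := down s; have [q [qt lq]] := down t.
exists (p ++ rev (belast t q)).
rewrite cat_path last_cat ps lp -{1}lq rev_path; split.
  by rewrite (eq_path (e' := seqtree_adj)) // => x y; apply: seqtree_adj_sym.
case: q {qt} lq => [|u q] /= lq; first by rewrite lq.
by rewrite rev_cons last_rcons.
Qed.

Lemma seqtree_acyclic : acyclic seqtree.
Proof.
case=> c [sc cc uc].
have {}uc : uniq (c : seq (seq nat)).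
  elim: c uc {sc cc} => //= x c IH /andP [xc /IH ->]; rewrite andbT.
  apply: contra xc; elim: c {IH} => //= y c IH.
  rewrite !in_cons => /orP [/eqP ->|/IH ->]; last by rewrite orbT.
  by rewrite eqxx.
have [x xc xmax] : exists2 x, x \in (c : seq (seq nat)) &
    forall y, y \in (c : seq (seq nat)) -> size y <= size x.
  have : 0 < size c by apply: leq_trans sc.
  elim: (c : seq (seq nat)) => // a [|b d] IH _.
    by exists a; rewrite ?mem_head // => y; rewrite inE => /eqP ->.
  have [//|x xd xmax] := IH.
  have [le|lt] := leqP (size a) (size x).
    exists x => [|y]; first by rewrite in_cons xd orbT.
    by rewrite in_cons => /orP [/eqP ->|/xmax].
  exists a => [|y]; first exact: mem_head.
  by rewrite in_cons => /orP [/eqP -> //|/xmax h]; apply: leq_trans (ltnW lt).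
have [i p cE] := rot_to xc.
have pc y : y \in p -> size y <= size x.
  by move=> yp; apply: xmax; rewrite -(mem_rot i) cE in_cons yp orbT.
move: sc cc uc; rewrite -(size_rot i) -(rot_cycle i) -(rot_uniq i) cE.
case: p cE pc => [|a [|b p]] //= _ pc _.
rewrite rcons_path => /andP [xa /andP [_ /andP [_ lx]]].
move=> /and4P [_ aN _ _].
have aE := seqtree_adj_behead xa (pc _ (mem_head _ _)).
have lE : last b p = behead x.
  apply: seqtree_adj_behead; first by rewrite seqtree_adj_sym.
  by apply: pc; rewrite in_cons mem_last orbT.
by move: aN; rewrite aE -lE mem_last.
Qed.

Lemma seqtree_degree (s : seqtree) : (neighbors s #= [set: nat])%card.
Proof.
rewrite card_eq_le; apply/andP; split.
  exact: (@countableP (seq nat)).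
apply/infiniteP => fin.
have : finite_set ((fun t : seq nat => head 0 t) @` neighbors s).
  exact: finite_image.
apply: (@sub_infinite_set _ [set: nat]); last exact: infinite_nat.
move=> n _; exists (n :: s) => //.
by rewrite /neighbors /= /seqtree_adj /= eqxx orbT.
Qed.

Lemma exists_T_aleph0 : exists T : sgraph, is_T_aleph0 T.
Proof.
exists seqtree; split; last exact: seqtree_degree.
split; [exact: (inhabits [::]) | exact: seqtree_connected |].
exact: seqtree_acyclic.
Qed.

End Existence.

(* Main.v *)
(* Let X, Y be disjoint finite connected vertex sets and D a further set of
   vertices such that G[X + Y + D], with X and Y contracted, is infinitely
   edge-connected. A path split replaces this by two such configurations
   (X', Z; D1) and (Z, Y'; D2), a star split by (X', Y'; D1) and (X', Z; D2)
   with an edge between Y' and Z, where X' and Y' extend X and Y and everything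
   is disjoint. Iterating path splits along the binary tree gives a minor model
   of the halved Farey graph, hence of the Farey graph by contracting its first
   edge; iterating star splits keeps one terminal in common and gives the apex
   over an infinitely branching tree.

   Suppose some configuration has no path split. If a configuration and all its
   star descendants have star splits at X, we get the apex graph. Otherwise some
   descendant has no star split at X, and still no path split, because splits of
   descendants extend to the ancestor. Repeating this with the terminals swapped
   leaves the apex graph or a configuration without any split. In the latter
   case D contains an infinitely edge-connected induced subgraph D' to which
   both X and Y have infinite degree. If Z is a finite connected subset of D'
   adjacent to X and Y, then X, Y and Z all have infinite degree to one suitable
   component of D' - Z, and so does every finite connected set adjacent to X that
   has infinite degree to D'. Iterating gives an infinite complete minor. *)
Require Import Defs.
From mathcomp Require Import all_boot all_order all_algebra zify.
From mathcomp Require Import boolp classical_sets functions cardinality.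
Import Order.TTheory GRing.Theory Num.Theory.

Set Implicit Arguments.
Unset Strict Implicit.
Unset Printing Implicit Defensive.

Local Open Scope classical_set_scope.

(** * Pointwise reasoning about sets and edges *)

Definition disj (T : Type) (A B : set T) := forall v, A v -> B v -> False.

Ltac unfold_sets := unfold setU, setD, setI, set1, set0, mkset, subset, disj in *; cbn beta in *; unfold not in *.

(* Goals about sets are settled vertex by vertex: every inclusion and every
   disjointness is instantiated at the given vertices, and what remains is
   propositional. *)
Ltac propagate := repeat match goal with
  | H : False |- _ => destruct H
  | H : _ /\ _ |- _ => destruct H
  | H : _ <-> _ |- _ => destruct H
  | H : ?P -> ?Q, K : ?P |- _ => specialize (H K)
  | H : ?A \/ ?B -> ?Q |- _ =>
      pose proof (fun a : A => H (or_introl a));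
      pose proof (fun b : B => H (or_intror b)); clear H
  | H : ?A /\ ?B -> ?Q |- _ =>
      pose proof (fun (a : A) (b : B) => H (conj a b)); clear H
  | |- _ -> _ => intro
  end; try assumption.

Ltac prop := propagate;
  match goal with
  | |- _ /\ _ => split; prop
  | H : _ \/ _ |- _ => destruct H; prop
  | |- _ \/ _ => solve [left; prop | right; prop]
  | _ => idtac
  end.

Ltac pointwise2 a b :=
  repeat match goal with
  | H : disj _ _ |- _ => generalize (H a) (H b); clear H
  | H : _ `<=` _ |- _ => generalize (H a) (H b); clear H
  end; unfold_sets; intros; solve [prop].

Ltac pointwise v :=
  repeat match goal with
  | H : disj _ _ |- _ => generalize (H v); clear H
  | H : _ `<=` _ |- _ => generalize (H v); clear H
  end; unfold_sets; intros; solve [prop].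

Ltac setp := let v := fresh "v" in intros v; pointwise v.

(** The [edgewise] tactics compare two cuts edge by edge; their arguments are the sets whose
    membership has to be decided at both ends of the edge. *)
Ltac em P a b := pose proof (EM (P a)); pose proof (EM (P b)).
Ltac edgewise0 := let a := fresh "a" in let b := fresh "b" in
  intros a b ? ? ?; pointwise2 a b.
Ltac edgewise P := let a := fresh "a" in let b := fresh "b" in
  intros a b ? ? ?; em P a b; pointwise2 a b.
Ltac edgewise2 P Q := let a := fresh "a" in let b := fresh "b" in
  intros a b ? ? ?; em P a b; em Q a b; pointwise2 a b.

(** * Infinite cuts and finite connected sets *)

Section Cuts.
Variable G : sgraph.
Implicit Types A B C D P Q X Y Z U : set G.

Lemma adjC (a b : G) : adj a b -> adj b a.
Proof. by rewrite adj_sym. Qed.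

(** Finiteness by a list of ordered pairs that may contain too much: vertices carry no decidable
    equality, and bounds then combine by concatenation. *)
Definition finite_rel (R : G -> G -> Prop) :=
  exists l : seq (G * G), forall a b, R a b -> List.In (a, b) l.

Definition crossing A B (a b : G) := [/\ A a, B b & adj a b].

Definition fin_cut A B := finite_rel (crossing A B).
Definition inf_cut A B := ~ fin_cut A B.

Lemma finite_rel_sub (R S : G -> G -> Prop) :
  finite_rel S -> (forall a b, R a b -> S a b) -> finite_rel R.
Proof. by move=> [l hl] h; exists l => a b /h /hl. Qed.

Lemma finite_relU (R S : G -> G -> Prop) :
  finite_rel R -> finite_rel S -> finite_rel (fun a b => R a b \/ S a b).
Proof.
move=> [l hl] [m hm]; exists (l ++ m) => a b.
by rewrite List.in_app_iff => -[/hl|/hm]; tauto.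
Qed.

Lemma finite_relC (R : G -> G -> Prop) :
  finite_rel R -> finite_rel (fun a b => R b a).
Proof.
move=> [l hl]; exists [seq (p.2, p.1) | p <- l] => a b /hl h.
exact: (List.in_map (fun p : G * G => (p.2, p.1)) _ _ h).
Qed.

(** Apart from finitely many edges between [F] and [F'], every edge of the old cut belongs to the
    new one, in one direction or the other. Nearly all later comparisons of cuts go through this
    principle. *)
Lemma inf_cut_trade A B A' B' F F' : inf_cut A B -> fin_cut F F' ->
  (forall a b, adj a b -> A a -> B b ->
     (A' a /\ B' b) \/ (A' b /\ B' a) \/ (F a /\ F' b) \/ (F b /\ F' a)) ->
  inf_cut A' B'.
Proof.
move=> iAB fF h fA; apply: iAB.
apply: (finite_rel_sub (finite_relU (finite_relU fA (finite_relC fA))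
                                    (finite_relU fF (finite_relC fF)))).
move=> a b [Aa Bb ab]; have ba := adjC ab.
have [[? ?]|[[? ?]|[[? ?]|[? ?]]]] := h a b ab Aa Bb; rewrite /crossing; cbv beta.
- by do 2 left.
- by left; right.
- by right; left.
- by right; right.
Qed.

Lemma fin_cut0 A : fin_cut A set0.
Proof. by exists [::] => a b []. Qed.

Lemma inf_cut_sub A B A' B' : inf_cut A B ->
  (forall a b, adj a b -> A a -> B b -> (A' a /\ B' b) \/ (A' b /\ B' a)) ->
  inf_cut A' B'.
Proof.
move=> iAB h; apply: (inf_cut_trade iAB (fin_cut0 set0)) => a b ab Aa Bb.
by have := h a b ab Aa Bb; tauto.
Qed.

Lemma inf_cut_edge A B : inf_cut A B -> exists a b, [/\ A a, B b & adj a b].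
Proof.
move=> iAB; apply: contrapT => h; apply: iAB; exists [::] => a b c.
by apply: h; exists a, b.
Qed.

Definition fin_set A := exists l : seq G, forall a, A a -> List.In a l.

Lemma fin_setU A B : fin_set A -> fin_set B -> fin_set (A `|` B).
Proof.
move=> [l hl] [m hm]; exists (l ++ m) => a.
by rewrite List.in_app_iff => -[/hl|/hm]; tauto.
Qed.

Lemma fin_set1 (a : G) : fin_set [set a].
Proof. by exists [:: a] => b ->; left. Qed.

Lemma fin_cut_fin_set A B : fin_set A -> fin_set B -> fin_cut A B.
Proof.
move=> [l hl] [m hm]; exists (List.list_prod l m) => a b [/hl ? /hm ? _].
exact: List.in_prod.
Qed.

(* Equivalent to connectedness of the induced subgraph, without mentioning
   paths. *)
Definition cut_connected A := forall P, (exists a, A a /\ P a) ->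
  (exists a, A a /\ ~ P a) ->
  exists a b, [/\ A a, A b, P a, ~ P b & adj a b].

Lemma cut_connected1 (a : G) : cut_connected [set a].
Proof. by move=> P [b [-> ?]] [c [-> ?]]. Qed.

Lemma cut_connectedU A B a b : cut_connected A -> cut_connected B ->
  A a -> B b -> (a = b \/ adj a b) -> cut_connected (A `|` B).
Proof.
move=> cA cB Aa Bb ab P [p [ABp Pp]] [q [ABq Pq]].
have [] := EM (exists a b, [/\ A a, A b, P a, ~ P b & adj a b]).
  by move=> [u [v [? ? ? ? ?]]]; exists u, v; split=> //; left.
have [] := EM (exists a b, [/\ B a, B b, P a, ~ P b & adj a b]).
  by move=> [u [v [? ? ? ? ?]]] _; exists u, v; split=> //; right.
move=> nB nA.
have hA u v : A u -> P u -> A v -> P v.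
  move=> Au Pu Av; apply: contrapT => nPv; apply: nA.
  by apply: cA; [exists u | exists v].
have hB u v : B u -> P u -> B v -> P v.
  move=> Bu Pu Bv; apply: contrapT => nPv; apply: nB.
  by apply: cB; [exists u | exists v].
case: ABp => [Ap|Bp]; case: ABq => [Aq|Bq].
- by case: Pq; apply: hA Ap Pp Aq.
- have Pa := hA _ _ Ap Pp Aa; have nPb : ~ P b by move=> Pb; case: Pq; apply: hB Bb Pb Bq.
  case: ab => [e|ab]; first by rewrite e in Pa.
  by exists a, b; split=> //; [left|right].
- have Pb := hB _ _ Bp Pp Bb; have nPa : ~ P a by move=> Pa; case: Pq; apply: hA Aa Pa Aq.
  case: ab => [e|ab]; first by rewrite e in nPa.
  by exists b, a; split=> //; [right|left| rewrite adj_sym].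
- by case: Pq; apply: hB Bp Pp Bq.
Qed.

Lemma cut_connected_bigcup (I : Type) (F : I -> set G) (c : G) :
  (forall i, cut_connected (F i)) -> (forall i, F i c) ->
  cut_connected [set v | exists i, F i v].
Proof.
move=> cF Fc P [p [[i Fp] Pp]] [q [[j Fq] nPq]].
have [Pc|nPc] := EM (P c).
  have [|a [b [? ? ? ? ?]]] := cF j P (ex_intro _ c (conj (Fc j) Pc)).
    by exists q.
  by exists a, b; split=> //; exists j.
have [|a [b [? ? ? ? ?]]] := cF i P (ex_intro _ p (conj Fp Pp)).
  by exists c.
by exists a, b; split=> //; exists i.
Qed.

Lemma cut_connected_induced A : cut_connected A -> connected (induced A).
Proof.
move=> cA [x Ax] [y Ay].
(* [P] consists of the vertices joined to [x] in the induced subgraph; an edge of [A] leaving [P]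
   would prolong a path. *)
pose P := [set v | exists h : v \in A, linked (exist _ x Ax : induced A) (exist _ v h)].
have [[h [p [pp lp]]]|nPy] := EM (P y).
  exists p; split=> //; rewrite lp; congr exist; exact: Prop_irrelevance.
have Px : P x.
  exists Ax; exists [::]; split=> //.
have [||a [b [Aa Ab [ha [p [pp lp]]] nPb ab]]] := cA P.
- by exists x; split=> //; exact: set_mem.
- by exists y; split=> //; exact: set_mem.
case: nPb; exists (mem_set Ab); exists (rcons p (exist _ b (mem_set Ab))).
by rewrite rcons_path last_rcons pp lp.
Qed.

Definition fin_conn A := [/\ (exists a, A a), fin_set A & cut_connected A].

Lemma fin_conn1 (a : G) : fin_conn [set a].
Proof. by split; [exists a|exact: fin_set1|exact: cut_connected1]. Qed.

Lemma fin_connU A B a b : fin_conn A -> fin_conn B ->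
  A a -> B b -> (a = b \/ adj a b) -> fin_conn (A `|` B).
Proof.
move=> [[a0 Aa0] fA cA] [_ fB cB] Aa Bb ab; split.
- by exists a0; left.
- exact: fin_setU.
- exact: (cut_connectedU cA cB Aa Bb ab).
Qed.

(** A path from [X] through [D] to [b] is recorded as a finite connected enlargement of [X], which
    can serve directly as a new terminal. *)
Definition reaches X D (b : G) :=
  exists X', [/\ fin_conn X', X `<=` X', X' `<=` X `|` D & X' b].

Lemma reaches_step X D a b : fin_conn X -> (X `|` D) a -> adj a b ->
  X b \/ reaches X D b -> reaches X D a.
Proof.
move=> fX Da ab h.
have [X' [fX' sX sX' Xb]] : reaches X D b.
  by case: h => // Xb; exists X; split=> // v; left.
exists (X' `|` [set a]); split.
- by apply: (fin_connU fX' (fin_conn1 a) Xb (erefl a)); right; apply: adjC.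
- by move=> v /sX; left.
- by move=> v [/sX'|->].
- by right.
Qed.

(** The hypothesis, applied to the set of unreached vertices, gives an edge from it to [X] or to a
    reached vertex; its first end is then reached after all. *)
Lemma reaches_all X D : fin_conn X ->
  (forall P a, P `<=` D -> P a -> exists a b, [/\ P a, ((D `\` P) `|` X) b & adj a b]) ->
  forall b, D b -> reaches X D b.
Proof.
move=> fX h b Db; apply: contrapT => nb.
pose P := [set v | D v /\ ~ reaches X D v].
have [|a [c [[Da na] Pc ac]]] := h P b _ (conj Db nb); first by move=> v [].
case: na; apply: (reaches_step fX _ ac); first by right.
case: Pc => [[Dc nc]|Xc]; last by left.
by right; apply: contrapT => nr; apply: nc; split.
Qed.

End Cuts.

(** * Good terminals and their splits *)

Section Resources.
Variable G : sgraph.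
Implicit Types A B C D P Q X Y Z U M : set G.

(* G[X + Y + D] with X and Y contracted to single vertices is infinitely
   edge-connected: the first clause is about cuts with X and Y on one side, the
   second about cuts that separate X from Y. *)
Definition good X Y D :=
  (forall P a, P `<=` D -> P a -> inf_cut P ((D `\` P) `|` (X `|` Y))) /\
  (forall P, P `<=` D -> inf_cut (X `|` P) (Y `|` (D `\` P))).

(* The graph G[X + A] with X contracted is infinitely edge-connected. *)
Definition attached X A :=
  forall P a, P `<=` A -> P a -> inf_cut P ((A `\` P) `|` X).

(** A set with at most one vertex qualifies vacuously; for finite [X], [inf_cut X D] rules that case
    out. *)
Definition inf_conn D := forall P a b, P `<=` D -> P a -> D b -> ~ P b ->
  inf_cut P (D `\` P).

Lemma good_sym X Y D : good X Y D -> good Y X D.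
Proof.
move=> [g1 g2]; split=> [P a sP Pa|P sP].
  by apply: (inf_cut_sub (g1 P a sP Pa)); edgewise0.
have sD : D `\` P `<=` D by move=> v [].
by apply: (inf_cut_sub (g2 _ sD)); edgewise P.
Qed.

(** A cut that separates [X] from [Z] is a cut around its [Z]-side, a non-empty subset of [A], and
    is therefore infinite. *)
Lemma good_attached X Z A a : attached X A -> Z `<=` A -> Z a ->
  good X Z (A `\` Z).
Proof.
move=> aA sZ Za; split=> [P p sP Pp|P sP].
  have sPA : P `<=` A by setp.
  by apply: (inf_cut_sub (aA P p sPA Pp)); edgewise Z.
have sQ : Z `|` ((A `\` Z) `\` P) `<=` A by setp.
apply: (inf_cut_sub (aA _ a sQ _)); first by left.
by edgewise2 Z P.
Qed.

(** Contracting more vertices into a terminal creates no new cuts: each cut pulls back to one with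
    [X'] on the side of [X]. *)
Lemma good_grow X Y D X' : good X Y D -> X `<=` X' -> good X' Y (D `\` X').
Proof.
move=> [g1 g2] sX; split=> [P a sP Pa|P sP].
  have sPD : P `<=` D by setp.
  by apply: (inf_cut_sub (g1 P a sPD Pa)); edgewise X'.
have sPD : (P `|` X') `&` D `<=` D by setp.
by apply: (inf_cut_sub (g2 _ sPD)); edgewise2 P X'.
Qed.

Lemma good_growr X Y D Y' : good X Y D -> Y `<=` Y' -> good X Y' (D `\` Y').
Proof. by move=> /good_sym g /(good_grow g)/good_sym. Qed.

(** A cut that does not divide [D] has [D] on one side and some terminal on the other. *)
Lemma good_inf_conn X Y D : inf_conn D -> inf_cut X D -> inf_cut Y D ->
  good X Y D.
Proof.
move=> cD iX iY; split=> [P a sP Pa|P sP].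
  have [[b [Db nPb]]|h] := EM (exists b, D b /\ ~ P b).
    by apply: (inf_cut_sub (cD P a b sP Pa Db nPb)); edgewise0.
  have sD : D `<=` P by move=> v Dv; apply: contrapT => nP; apply: h; exists v.
  by apply: (inf_cut_sub iX); edgewise0.
have [[b [Db nPb]]|h] := EM (exists b, D b /\ ~ P b); last first.
  have sD : D `<=` P by move=> v Dv; apply: contrapT => nP; apply: h; exists v.
  by apply: (inf_cut_sub iY); edgewise0.
have [[a Pa]|h'] := EM (exists a, P a).
  by apply: (inf_cut_sub (cD P a b sP Pa Db nPb)); edgewise0.
have sD : disj D P by move=> v Dv Pv; apply: h'; exists v.
by apply: (inf_cut_sub iX); edgewise0.
Qed.

Record five_disjoint U A B C D1 D2 : Prop := FiveDisjoint {
  fiveAB : disj A B; fiveAC : disj A C; fiveBC : disj B C;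
  fiveAD1 : disj A D1; fiveBD1 : disj B D1; fiveCD1 : disj C D1;
  fiveAD2 : disj A D2; fiveBD2 : disj B D2; fiveCD2 : disj C D2;
  fiveD12 : disj D1 D2;
  fiveA : A `<=` U; fiveB : B `<=` U; fiveC : C `<=` U;
  fiveD1 : D1 `<=` U; fiveD2 : D2 `<=` U }.

(** The bound [U] stands in for X + Y + D. Splits become monotone in the terminals and in [U], so
    that a split found deep in a construction is also one of its ancestor. *)
Definition path_split X Y U := exists X' Y' Z D1 D2,
  [/\ [/\ fin_conn X', fin_conn Y' & fin_conn Z],
      X `<=` X', Y `<=` Y', five_disjoint U X' Y' Z D1 D2 &
      good X' Z D1 /\ good Y' Z D2].

Definition star_split X Y U := exists X' Y' Z D1 D2,
  [/\ [/\ fin_conn X', fin_conn Y' & fin_conn Z],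
      X `<=` X', Y `<=` Y', five_disjoint U X' Y' Z D1 D2 &
      [/\ good X' Y' D1, good X' Z D2 & exists y z, [/\ Y' y, Z z & adj y z]]].

Lemma five_disjoint_sub U U' A B C D1 D2 : five_disjoint U A B C D1 D2 ->
  U `<=` U' -> five_disjoint U' A B C D1 D2.
Proof. by case=> *; split=> //; setp. Qed.

Lemma path_split_sub X Y U X' Y' U' : path_split X Y U ->
  X' `<=` X -> Y' `<=` Y -> U `<=` U' -> path_split X' Y' U'.
Proof.
move=> [X1 [Y1 [Z [D1 [D2 [fc sX sY d g]]]]]] hX hY hU.
exists X1, Y1, Z, D1, D2; split=> //; try setp.
exact: five_disjoint_sub hU.
Qed.

Lemma star_split_sub X Y U X' Y' U' : star_split X Y U ->
  X' `<=` X -> Y' `<=` Y -> U `<=` U' -> star_split X' Y' U'.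
Proof.
move=> [X1 [Y1 [Z [D1 [D2 [fc sX sY d g]]]]]] hX hY hU.
exists X1, Y1, Z, D1, D2; split=> //; try setp.
exact: five_disjoint_sub hU.
Qed.

Lemma path_split_sym X Y U : path_split X Y U -> path_split Y X U.
Proof.
move=> [X1 [Y1 [Z [D1 [D2 [[? ? ?] sX sY d [? ?]]]]]]].
by exists Y1, X1, Z, D2, D1; split=> //; case: d => *; split=> //; setp.
Qed.

(** If some [A] had only finitely many edges to (D \ A) + Y, then [A] would stay attached to [X],
    and D \ A would stay good for [X] and [Y]. By [tidy] all of [D] can be reached from [Y], which
    supplies the edge between [Y'] and [Z] of a star split. *)
Lemma attached_of_no_star X Y D U : fin_conn X -> fin_conn Y ->
  disj X Y -> disj X D -> disj Y D -> X `|` (Y `|` D) `<=` U ->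
  good X Y D ->
  (forall A a, A `<=` D -> A a ->
     exists b c, [/\ A b, ((D `\` A) `|` Y) c & adj b c]) ->
  ~ star_split X Y U -> attached Y D.
Proof.
move=> fX fY XY XD YD sU [g1 g2] tidy nS A a sA Aa fA; apply: nS.
pose B := D `\` A.
(* A path from [Y] has to enter [A] somewhere: [tidy], applied to the vertices of [D] outside [L],
   gives an edge to [L] or [Y], and its other end [m] must lie in [A]. *)
pose L := [set c | B c /\ reaches Y B c].
have [||m [c [[Dm nLm] Lc mc]]] := tidy [set v | D v /\ ~ L v] a.
- by move=> v [].
- by split; [exact: sA|move=> -[[]]].
have rc : Y c \/ reaches Y B c.
  case: Lc => [[Dc nc]|]; last by left.
  by right; apply: contrapT => nr; apply: nc; split=> // -[_ /nr].
have Am : A m.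
  apply: contrapT => nA; apply: nLm; split; first by split.
  by apply: (reaches_step fY _ mc rc); right; split.
have [Y' [fY' sY' Y's Y'c]] : exists Y', [/\ fin_conn Y', Y `<=` Y',
    Y' `<=` Y `|` B & Y' c].
  by case: rc => // Yc; exists Y; split=> // v; left.
have BE : forall v, B v <-> D v /\ ~ A v by [].
move: (B) BE Y's => {L nLm Lc rc} {}B BE Y's.
have BD : B `<=` D by move=> v /BE [].
have BA : disj B A by move=> v /BE [].
have aA : attached X A.
  move=> P p sP Pp; have sPD : P `<=` D by setp.
  apply: (inf_cut_trade (g1 P p sPD Pp) fA).
  by edgewise A.
have gB : good X Y B.
  split=> [P p sP Pp|P sP].
    have sPD : P `<=` D by setp.
    apply: (inf_cut_trade (g1 P p sPD Pp) fA) => u v.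
    have := BE u; have := BE v; move: u v.
    by move=> u v ? ? ? ? ?; em A u v; pointwise2 u v.
  (* [A] is put on the side of [X]; its edges to [Y] and [B] form the finite cut that may be
     discarded. *)
  have sPD : P `|` A `<=` D by setp.
  apply: (inf_cut_trade (g2 _ sPD) fA) => u v.
  have := BE u; have := BE v; move: u v.
  by move=> u v ? ? ? ? ?; em A u v; em P u v; pointwise2 u v.
exists X, Y', [set m], (B `\` Y'), (A `\` [set m]); split=> //.
- by split=> //; exact: fin_conn1.
- have sm : [set m] `<=` A by move=> v ->.
  by split; setp.
- split; first exact: good_growr gB sY'.
  + by apply: (good_attached aA (a := m)) => // v ->.
  + by exists c, m; split=> //; exact: adjC.
Qed.

(** A finite cut of [D] into [A] and [B] leaves both parts attached to [X] and to [Y]. Then (X, Y;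
    B) together with [A] around a neighbour [m] of [Y] is a star split. *)
Lemma inf_conn_of_no_star X Y D U : fin_conn X -> fin_conn Y ->
  disj X Y -> disj X D -> disj Y D -> X `|` (Y `|` D) `<=` U ->
  attached X D -> attached Y D -> ~ star_split X Y U -> inf_conn D.
Proof.
move=> fX fY XY XD YD sU aX aY nS A a b sA Aa Db nAb fAB; apply: nS.
have BE : forall v, (D `\` A) v <-> D v /\ ~ A v by [].
move: (D `\` A) BE fAB => B BE fAB.
have BD : B `<=` D by move=> v /BE [].
have BA : disj B A by move=> v /BE [].
have sDB : D `<=` A `|` B.
  by move=> v Dv; have [|] := EM (A v); [left|right; apply/BE].
have Bb : B b by apply/BE.
have iAY : inf_cut A Y.
  by apply: (inf_cut_trade (aY A a sA Aa) fAB); edgewise0.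
have [m [y [Am Yy my]]] := inf_cut_edge iAY.
have sm : [set m] `<=` A by move=> v ->.
exists X, Y, [set m], B, (A `\` [set m]); split=> //.
- by split=> //; exact: fin_conn1.
- by split; setp.
split.
- split=> [P p sP Pp|P sP].
    have sPD : P `<=` D by setp.
    by apply: (inf_cut_trade (aX P p sPD Pp) fAB); edgewise0.
  have [[p Pp]|h] := EM (exists p, P p).
    have sPD : P `<=` D by setp.
    by apply: (inf_cut_trade (aY P p sPD Pp) fAB); edgewise0.
  have eP : disj P D by move=> v Pv _; apply: h; exists v.
  by apply: (inf_cut_trade (aX B b BD Bb) fAB); edgewise0.
- apply: (good_attached _ sm (erefl m)) => P p sP Pp.
  have sPD : P `<=` D by setp.
  by apply: (inf_cut_trade (aX P p sPD Pp) fAB); edgewise0.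
- by exists y, m; split=> //; exact: adjC.
Qed.

Definition no_edge A B := forall a b, A a -> B b -> ~ adj a b.

Definition unsplittable X Y U :=
  [/\ ~ path_split X Y U, ~ star_split X Y U & ~ star_split Y X U].

(** Once the parts of [D] that are not joined to both terminals are removed, the rest is tidy
    towards [X] and towards [Y]. Both directions of [attached_of_no_star] then apply, followed by
    [inf_conn_of_no_star]. *)
Lemma unsplittable_inf_conn X Y D U : fin_conn X -> fin_conn Y ->
  disj X Y -> disj X D -> disj Y D -> X `|` (Y `|` D) `<=` U ->
  good X Y D -> unsplittable X Y U ->
  exists D', [/\ D' `<=` D, no_edge D' (D `\` D'), inf_conn D',
    inf_cut X D' & inf_cut Y D'].
Proof.
move=> fX fY XY XD YD sU [g1 g2] [_ nS nS'].
(* far W is the part of D that is not joined to W inside D *)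
pose far W := [set v | exists A, [/\ A `<=` D, A v & no_edge A ((D `\` A) `|` W)]].
have farD W : far W `<=` D by move=> v [A [sA Av _]]; exact: sA.
have far_edge W : no_edge (far W) ((D `\` far W) `|` W).
  move=> u v [A [sA Au nA]] h; refine (nA _ _ Au _); case: h => [[Dv nv]|]; last by right.
  by left; split=> // Av; apply: nv; exists A.
pose D' := D `\` (far X `|` far Y).
have sD : D' `<=` D by move=> v [].
have D'far W : disj D' (far W) -> no_edge D' (far W).
  by move=> d u v D'u fv uv; apply: (far_edge W v u fv _ (adjC uv)); left; split;
    [exact: sD|move=> ?; apply: (d u)].
have dX : disj D' (far X) by move=> v [_ n] f; apply: n; left.
have dY : disj D' (far Y) by move=> v [_ n] f; apply: n; right.
have nX := D'far _ dX; have nY := D'far _ dY.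
have tidy W : no_edge D' (far W) -> disj D' (far W) -> (W = X \/ W = Y) -> forall A a, A `<=` D' -> A a ->
     exists b c, [/\ A b, ((D' `\` A) `|` W) c & adj b c].
  move=> nW dW hW A a sA Aa; apply: contrapT => h.
  suff fa : far W a by apply: (dW a) => //; exact: sA.
  exists A; split=> //; first by setp.
  move=> u v Au hv uv; apply: h; exists u, v; split=> //.
  case: hv => [[Dv nAv]|]; last by right.
  left; split=> //; split=> // -[fv|fv].
  - exact: (nX u v (sA u Au) fv uv).
  - exact: (nY u v (sA u Au) fv uv).
have D'E v : D v -> D' v \/ far X v \/ far Y v.
  move=> Dv; have [?|?] := EM (far X v); first by right; left.
  have [?|?] := EM (far Y v); first by right; right.
  by left; split=> // -[].
have gD : good X Y D'.
  split=> [P a sP Pa|P sP].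
    have sPD : P `<=` D by setp.
    apply: (inf_cut_sub (g1 P a sPD Pa)) => u v uv Pu [[Dv nPv]|XYv]; last by left; split=> //; right.
    left; split=> //; left; split=> //.
    have [//|[fv|fv]] := D'E v Dv.
    + by case: (nX u v (sP u Pu) fv).
    + by case: (nY u v (sP u Pu) fv).
  (* [far Y] is put on the side of [X] and the remainder of [far X] on the side of [Y]; neither
     contributes an edge to the cut. *)
  have sPD : P `|` far Y `<=` D.
    by have := farD Y; have := sP => ? ?; setp.
  apply: (inf_cut_sub (g2 _ sPD)) => u v uv hu hv.
  have nYu : ~ far Y u.
    move=> fu; case: (far_edge Y u v fu) => //.
    by case: hv => [|[Dv nv]]; [right|left; split=> // fv; apply: nv; right].
  have nXv : ~ far X v.
    move=> fv; apply: (far_edge X v u fv _ (adjC uv)).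
    case: hu => [|[Pu|//]]; [by right|left; split; first by exact: sPD _ (or_introl Pu)].
    by move=> fu; apply: (dX u) => //; exact: sP.
  left; split; first by case: hu => [|[|//]]; [left|right].
  case: hv => [|[Dv nv]]; first by left.
  have [D'v|[//|fv]] := D'E v Dv; last by case: nv; right.
  by right; split=> // Pv; apply: nv; left.
have XD' : disj X D' by setp.
have YD' : disj Y D' by setp.
have sU' : X `|` (Y `|` D') `<=` U by setp.
have sU'' : Y `|` (X `|` D') `<=` U by setp.
have YX : disj Y X by setp.
have aY := attached_of_no_star fX fY XY XD' YD' sU' gD (tidy Y nY dY (or_intror erefl)) nS.
have aX := attached_of_no_star fY fX YX YD' XD' sU'' (good_sym gD) (tidy X nX dX (or_introl erefl)) nS'.
have cD := inf_conn_of_no_star fX fY XY XD' YD' sU' aX aY nS.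
have [d D'd] : exists d, D' d.
  apply: contrapT => h; case: gD => _ /(_ set0) [//|].
  have [_ fsX _] := fX; have [_ fsY _] := fY.
  apply: (@finite_rel_sub _ _ _ (fin_cut_fin_set fsX fsY)) => u v [hu hv uv].
  split=> //; first by case: hu.
  by case: hv => // -[D'v _]; case: h; exists v.
exists D'; split=> //.
- move=> u v D'u [Dv nv]; have [//|[fv|fv]] := D'E v Dv; [exact: nX|exact: nY].
- by apply: (inf_cut_sub (aX D' d _ D'd)) => //; edgewise0.
- by apply: (inf_cut_sub (aY D' d _ D'd)) => //; edgewise0.
Qed.

End Resources.

(** * Unsplittable terminals yield a complete minor *)

Section Unsplittable.
Variable G : sgraph.
Implicit Types A B C D P Q X Y Z U M : set G.

Definition touches A B := exists a b, [/\ A a, B b & adj a b].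

Lemma touchesC A B : touches A B -> touches B A.
Proof. by move=> [a [b [? ? /adjC ?]]]; exists b, a. Qed.

Lemma touches_sub A B A' B' : touches A B -> A `<=` A' -> B `<=` B' ->
  touches A' B'.
Proof. by move=> [a [b [? ? ?]]] sA sB; exists a, b; split; auto. Qed.

Lemma inf_cutU A B C : inf_cut (A `|` B) C -> inf_cut A C \/ inf_cut B C.
Proof.
move=> i; have [fA|] := EM (fin_cut A C); last by left.
by right; apply: (inf_cut_trade i fA); edgewise0.
Qed.

Lemma unsplittable_sub X Y U X' Y' U' : unsplittable X Y U ->
  X `<=` X' -> Y `<=` Y' -> U' `<=` U -> unsplittable X' Y' U'.
Proof.
move=> [nP nS nS'] hX hY hU; split.
- by move=> s; apply: nP; exact: path_split_sub s hX hY hU.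
- by move=> s; apply: nS; exact: star_split_sub s hX hY hU.
- by move=> s; apply: nS'; exact: star_split_sub s hY hX hU.
Qed.

Lemma inf_conn_sub_closed D1 D2 E v : inf_conn D1 -> D1 `<=` E ->
  no_edge D2 (E `\` D2) -> D1 v -> D2 v -> D1 `<=` D2.
Proof.
move=> c1 s1 n2 v1 v2 w w1; apply: contrapT => nw.
have sP : D1 `&` D2 `<=` D1 by move=> ? [].
have nPw : ~ (D1 `&` D2) w by move=> [].
have [a [b [[D1a D2a] [Db nP] ab]]] := inf_cut_edge (c1 _ v w sP (conj v1 v2) w1 nPw).
by apply: (n2 a b) => //; split; [exact: s1|move=> ?; apply: nP].
Qed.

(** Adding [Z] to [X] gives a part [D1], adding it to [Y] a part [D2]. If neither already serves
    both [X] and [Y], then [Z] has infinite degree to both parts. If they meet, [D2] lies in [D1],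
    which inherits the infinite degree of [X]; if not, they form a path split through [Z]. *)
Lemma unsplittable_shrink X Y Z D U : fin_conn X -> fin_conn Y -> fin_conn Z ->
  disj X Y -> disj X D -> disj Y D -> X `<=` U -> Y `<=` U -> D `<=` U ->
  unsplittable X Y U -> inf_conn D -> inf_cut X D -> inf_cut Y D ->
  Z `<=` D -> touches X Z -> touches Y Z ->
  exists D', [/\ D' `<=` D `\` Z, no_edge D' ((D `\` Z) `\` D'), inf_conn D' &
    [/\ inf_cut X D', inf_cut Y D' & inf_cut Z D']].
Proof.
move=> fX fY fZ XY XD YD sX sY sD uns cD iX iY sZ XZ YZ.
have g := good_inf_conn cD iX iY.
suff [D' [sD' nD' cD' [iX' iY']]] : exists D', [/\ D' `<=` D `\` Z,
    no_edge D' ((D `\` Z) `\` D'), inf_conn D' & inf_cut X D' /\ inf_cut Y D'].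
  exists D'; split=> //; split=> //.
  (* Within [D], edges leave [D'] only towards [Z], so the infinite cut around [D'] yields the
     infinite degree of [Z]. *)
  have [x [d [_ D'd _]]] := inf_cut_edge iX'.
  have [[z Zz] _ _] := fZ.
  have sD'D : D' `<=` D by setp.
  have nD'z : ~ D' z by move=> /sD' [].
  apply: (inf_cut_sub (cD D' d z sD'D D'd (sZ z Zz) nD'z)) => u v uv D'u [Dv nv].
  right; split=> //; apply: contrapT => nZ; apply: (nD' u v) => //.
have [D1 [s1 n1 c1 i1X i1Y]] : exists D', [/\ D' `<=` D `\` Z,
    no_edge D' ((D `\` Z) `\` D'), inf_conn D', inf_cut (X `|` Z) D' & inf_cut Y D'].
  have [x [z [? ? ?]]] := XZ.
  have fXZ : fin_conn (X `|` Z) by apply: (fin_connU (a := x) (b := z)) => //; right.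
  have e : D `\` (X `|` Z) = D `\` Z by apply/seteqP; split; setp.
  have gXZ := @good_grow _ _ _ _ (X `|` Z) g (fun v h => or_introl h).
  rewrite e in gXZ.
  apply: (unsplittable_inf_conn fXZ fY (U := U)) => //; try setp.
  by apply: (unsplittable_sub uns) => //; setp.
have [D2 [s2 n2 c2 i2X i2Y]] : exists D', [/\ D' `<=` D `\` Z,
    no_edge D' ((D `\` Z) `\` D'), inf_conn D', inf_cut X D' & inf_cut (Y `|` Z) D'].
  have [y [z [? ? ?]]] := YZ.
  have fYZ : fin_conn (Y `|` Z) by apply: (fin_connU (a := y) (b := z)) => //; right.
  have e : D `\` (Y `|` Z) = D `\` Z by apply/seteqP; split; setp.
  have gYZ := @good_growr _ _ _ _ (Y `|` Z) g (fun v h => or_introl h).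
  rewrite e in gYZ.
  apply: (unsplittable_inf_conn fX fYZ (U := U)) => //; try setp.
  by apply: (unsplittable_sub uns) => //; setp.
have [X1|Z1] := inf_cutU i1X; first by exists D1.
have [Y2|Z2] := inf_cutU i2Y; first by exists D2.
have [[v [v1 v2]]|d12] := EM (exists v, D1 v /\ D2 v).
  have s21 := inf_conn_sub_closed c2 s2 n1 v2 v1.
  by exists D1; split=> //; split=> //; apply: (inf_cut_sub i2X); edgewise0.
case: uns => []; case; exists X, Y, Z, D2, D1; split=> //.
- have D21 : disj D2 D1 by move=> v v2 v1; apply: d12; exists v.
  by split; setp.
- by split; exact: good_inf_conn.
Qed.

(** Otherwise [B] sends infinitely many edges to [Z] and the discarded part [M]. Then [X] with [B]
    absorbed is the common terminal of a star split, with [D'] towards [Y] and [M] towards [Z]. *)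
Lemma unsplittable_keeps_degree X Y Z D D' B U :
  fin_conn X -> fin_conn Y -> fin_conn Z ->
  disj X Y -> disj X D -> disj Y D -> X `<=` U -> Y `<=` U -> D `<=` U ->
  unsplittable X Y U -> inf_conn D -> Z `<=` D -> touches Y Z ->
  D' `<=` D `\` Z -> no_edge D' ((D `\` Z) `\` D') -> inf_conn D' ->
  inf_cut X D' -> inf_cut Y D' ->
  fin_conn B -> touches X B -> inf_cut B D -> disj B Y -> disj B D -> B `<=` U ->
  inf_cut B D'.
Proof.
move=> fX fY fZ XY XD YD sX sY sD [_ nS _] cD sZ YZ sD' nD' cD' iX iY fB XB iB BY BD sB fBD.
apply: nS; pose M := (D `\` Z) `\` D'.
have ME : forall v, M v <-> D v /\ ~ Z v /\ ~ D' v.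
  by move=> v; split=> [[[]]//|[? [? ?]]]; split.
have {}nD' : no_edge D' M := nD'.
move: (M) nD' ME => {}M nD' ME.
have sM : M `<=` D by move=> v /ME [].
have MZ : disj M Z by move=> v /ME [? []].
have MD : disj M D' by move=> v /ME [? []].
have DM : D `<=` M `|` (Z `|` D').
  move=> v Dv; have [?|?] := EM (Z v); first by right; left.
  by have [?|?] := EM (D' v); [right; right|left; apply/ME].
have [[z Zz] _ _] := fZ.
(* B has infinite degree to M, so (B, Z; M) is good and X absorbs B *)
have iP P a : P `<=` M -> P a -> inf_cut P ((M `\` P) `|` Z).
  move=> sP Pa.
  have sPD : P `<=` D by setp.
  have nPz : ~ P z by move=> /sP Mz; exact: MZ Mz Zz.
  apply: (inf_cut_sub (cD P a z sPD Pa (sZ z Zz) nPz)) => u v uv Pu [Dv nPv].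
  left; split=> //; have [?|[?|D'v]] := DM v Dv; [by left|by right|].
  by case: (nD' v u D'v (sP u Pu) (adjC uv)).
have gM : good B Z M.
  split=> [P a sP Pa|P sP]; first by apply: (inf_cut_sub (iP P a sP Pa)); edgewise0.
  have [[a Pa]|h] := EM (exists a, P a).
    by apply: (inf_cut_sub (iP P a sP Pa)); edgewise0.
  have eP : disj P M by move=> v Pv _; apply: h; exists v.
  by apply: (inf_cut_trade iB fBD); edgewise0.
have [x [b [Xx Bb xb]]] := XB.
have sXB : X `<=` X `|` B by move=> v; left.
exists (X `|` B), Y, Z, D', M; split=> //.
- by split=> //; apply: (fin_connU fX fB Xx Bb); right.
- by split; setp.
- split=> //.
  + by apply: good_inf_conn => //; apply: (inf_cut_sub iX); edgewise0.
  + have e : M `\` (X `|` B) = M by apply/seteqP; split; setp.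
    by rewrite -e; apply: (good_grow gM); move=> v; right.
Qed.

(** One neighbour in [D] of each listed set suffices; [Z] is extended inside [D] to these neighbours
    one at a time. *)
Lemma inf_conn_hub D d (l : seq (set G)) : inf_conn D -> D d ->
  (forall B, List.In B l -> inf_cut B D) ->
  exists Z, [/\ fin_conn Z, Z `<=` D & forall B, List.In B l -> touches B Z].
Proof.
move=> cD Dd; elim: l => [|B l IH] hl.
  by exists [set d]; split=> // [|v ->//]; exact: fin_conn1.
have [|Z [fZ sZ hZ]] := IH; first by move=> C ?; apply: hl; right.
have [b [c [Bb Dc bc]]] := inf_cut_edge (hl B (or_introl erefl)).
have [Z' [fZ' sZ' Z's Z'c]] : exists Z', [/\ fin_conn Z', Z `<=` Z', Z' `<=` D & Z' c].
  have [Zc|nZc] := EM (Z c); first by exists Z; split.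
  have [||Z' [? ? sZ' ?]] := @reaches_all _ Z (D `\` Z) fZ _ c; last first.
  - by exists Z'; split=> //; setp.
  - by split.
  move=> P a sP Pa; have [[z Zz] _ _] := fZ.
  have sPD : P `<=` D by setp.
  have [|u [v [Pu [Dv nPv] uv]]] := inf_cut_edge (cD P a z sPD Pa (sZ z Zz) _).
    by move=> /sP [].
  exists u, v; split=> //; have [?|?] := EM (Z v); first by right.
  by left.
exists Z'; split=> // C [<-|/hZ h]; first by exists b, c.
exact: touches_sub h (fun v h => h) sZ'.
Qed.

(** [l] holds the branch sets found so far and [D] the room for the next ones. Contact with [X] and
    infinite degree to [D] are kept because [unsplittable_keeps_degree] asks for them. *)
Record clique_stage X Y U (l : seq (set G)) D : Prop := CliqueStage {
  stage_inf_conn : inf_conn D;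
  stageX : inf_cut X D; stageY : inf_cut Y D;
  stageXD : disj X D; stageYD : disj Y D; stageU : D `<=` U;
  stage_sets : forall B, List.In B l ->
    [/\ fin_conn B, touches X B, inf_cut B D, disj B D & disj B Y /\ B `<=` U] }.

Lemma clique_step X Y U l D : fin_conn X -> fin_conn Y -> disj X Y ->
  X `<=` U -> Y `<=` U -> unsplittable X Y U -> clique_stage X Y U l D ->
  exists Z D', [/\ clique_stage X Y U (Z :: l) D', Z `<=` D &
                   forall B, List.In B l -> touches B Z].
Proof.
move=> fX fY XY sX sY uns [cD iX iY XD YD sD hl].
have [_ [d [_ Dd _]]] := inf_cut_edge iX.
have [|Z [fZ sZ hZ]] := @inf_conn_hub D d (X :: Y :: l) cD Dd.
  by move=> B [<-|[<-|/hl []]].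
have XZ : touches X Z by apply: hZ; left.
have YZ : touches Y Z by apply: hZ; right; left.
have [D' [sD' nD' cD' [iX' iY' iZ']]] :=
  unsplittable_shrink fX fY fZ XY XD YD sX sY sD uns cD iX iY sZ XZ YZ.
exists Z, D'; split=> //; last by move=> B ?; apply: hZ; right; right.
split=> //; try setp.
move=> B [<-|Bl].
  split=> //; last by split; setp.
  by move=> v Zv /sD' [].
have [fB XB iB BD [BY sB]] := hl B Bl.
split=> //; last by move=> v Bv /sD' [Dv _]; exact: BD Bv Dv.
exact: (unsplittable_keeps_degree fX fY fZ XY XD YD sX sY sD uns cD sZ).
Qed.

Lemma unsplittable_clique X Y D U : fin_conn X -> fin_conn Y ->
  disj X Y -> disj X D -> disj Y D -> X `|` (Y `|` D) `<=` U ->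
  good X Y D -> unsplittable X Y U ->
  exists B : nat -> set G, (forall n, fin_conn (B n)) /\
    (forall m n, (m < n)%N -> disj (B m) (B n) /\ touches (B m) (B n)).
Proof.
move=> fX fY XY XD YD sU gD uns.
have sX : X `<=` U by setp.
have sY : Y `<=` U by setp.
have [D0 [s0 _ c0 iX0 iY0]] := unsplittable_inf_conn fX fY XY XD YD sU gD uns.
have st0 : clique_stage X Y U [::] D0 by split=> //; setp.
pose T := {s : seq (set G) * set G | clique_stage X Y U s.1 s.2}.
have step (s : T) : {t : T | exists Z, [/\ (sval t).1 = Z :: (sval s).1,
    Z `<=` (sval s).2 & forall B, List.In B (sval s).1 -> touches B Z]}.
  apply: cid; case: s => [[l D1] /= st].
  have [Z [D' [st' sZ hZ]]] := clique_step fX fY XY sX sY uns st.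
  by exists (exist _ (Z :: l, D') st'), Z.
pose s n := iter n (fun t => sval (step t)) (exist _ ([::], D0) st0 : T).
(* Every step prepends one branch set, so the list after n + 1 steps is non-empty and the default
   [set0] is never taken. *)
pose B n := head set0 (sval (s n.+1)).1.
have sB n : [/\ (sval (s n.+1)).1 = B n :: (sval (s n)).1,
    B n `<=` (sval (s n)).2 & forall C, List.In C (sval (s n)).1 -> touches C (B n)].
  rewrite /B /=; case: (svalP (step (s n))) => Z [e ? ?].
  by rewrite /s /= -/(s n) e.
have InB m n : (m < n)%N -> List.In (B m) (sval (s n)).1.
  elim: n => // n IH; rewrite ltnS leq_eqVlt; have [-> _ _] := sB n.
  by case/orP => [/eqP ->|/IH]; [left|right].
exists B; split=> [n|m n mn].
  have [_ _ _ _ _ _ hl] := svalP (s n.+1).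
  by have [] := hl _ (InB n n.+1 (ltnSn n)).
have [_ _ _ _ _ _ hl] := svalP (s n).
have [_ sBn tBn] := sB n; have h := InB m n mn.
have [_ _ _ BD _] := hl _ h; split; last exact: tBn.
by move=> v Bv /sBn; exact: BD Bv.
Qed.

End Unsplittable.

(** * Trees of splits *)

Section Terminals.
Variable G : sgraph.
Implicit Types A B C D P Q X Y Z U M : set G.

(** Contact of the terminals is added to [good] because it becomes an edge of the minor: apex to
    branch, or [Low] to [High]. *)
Record resource X Y D : Prop := Resource {
  resX : fin_conn X; resY : fin_conn Y;
  resXY : disj X Y; resXD : disj X D; resYD : disj Y D;
  res_good : good X Y D; res_touch : touches X Y }.

(** The cut around everything reached from [X] has an edge, and by maximality that edge must end in
    [Y]. *)
Lemma resource_growl X Y D : fin_conn X -> fin_conn Y -> disj X Y ->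
  disj X D -> disj Y D -> good X Y D ->
  exists X', [/\ resource X' Y (D `\` X'), X `<=` X' & X' `<=` X `|` D].
Proof.
move=> fX fY XY XD YD g.
pose L := [set v | D v /\ reaches X D v].
have sL : L `<=` D by move=> v [].
have [p [q [Lp hq pq]]] := inf_cut_edge (g.2 _ sL).
have rp : X p \/ reaches X D p by case: Lp => [|[]]; [left|right].
have Yq : Y q.
  case: hq => // -[Dq nL]; case: nL; split=> //.
  by apply: (reaches_step fX _ (adjC pq) rp); right.
have [X' [fX' sX sX' X'p]] : reaches X D p.
  by case: rp => // Xp; exists X; split=> // v; left.
exists X'; split=> //; split=> //; try setp; first exact: good_grow g sX.
by exists p, q.
Qed.

Lemma resource_sym X Y D : resource X Y D -> resource Y X D.
Proof.
by case=> *; split=> //; [setp|exact: good_sym|exact: touchesC].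
Qed.

Lemma resource_growr X Y D : fin_conn X -> fin_conn Y -> disj X Y ->
  disj X D -> disj Y D -> good X Y D ->
  exists Y', [/\ resource X Y' (D `\` Y'), Y `<=` Y' & Y' `<=` Y `|` D].
Proof.
move=> fX fY XY XD YD g.
have YX : disj Y X by setp.
have [Y' [r ? ?]] := resource_growl fY fX YX YD XD (good_sym g).
by exists Y'; split=> //; exact: resource_sym.
Qed.

End Terminals.

(** * Iterated star splits *)

Section StarTree.
Variables (G : sgraph) (R : Type) (X Y D : R -> set G) (c0 c1 : R -> R).
Hypothesis res : forall r, resource (X r) (Y r) (D r).
Hypothesis X0 : forall r, X r `<=` X (c0 r).
Hypothesis X01 : forall r, X (c1 r) = X (c0 r).
Hypothesis Y0 : forall r, Y r `<=` Y (c0 r).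
Hypothesis five : forall r, five_disjoint (X r `|` (Y r `|` D r))
  (X (c0 r)) (Y (c0 r)) (Y (c1 r)) (D (c0 r)) (D (c1 r)).
Hypothesis touch : forall r, touches (Y (c0 r)) (Y (c1 r)).

Let facts r : [/\ X (c0 r) `<=` X r `|` D r, X (c1 r) `<=` X r `|` D r,
  Y (c0 r) `<=` Y r `|` D r, Y (c1 r) `<=` D r &
  D (c0 r) `<=` D r /\ D (c1 r) `<=` D r].
Proof.
have := X0 (r := r); have := Y0 (r := r); case: (five r); case: (res r).
by rewrite X01 => *; split; [..|split]; setp.
Qed.

Let child r (w : seq bool) := foldl (fun r c => if c then c1 r else c0 r) r w.

(** The first terminals of all descendants unite to the apex. [c0] enlarges the second terminal and
    [c1] starts a new one, so the n-th child of a branch is split off after n steps [c0]. *)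
Let top r : set G := [set v | exists w, X (child r w) v].
Let root r : set G := [set v | exists n, Y (iter n c0 r) v].
Fixpoint star_branch r (s : seq nat) : set G :=
  if s is n :: s' then star_branch (c1 (iter n c0 r)) s' else root r.

Let X_child r w : X r `<=` X (child r w).
Proof.
elim: w r => [|c w IH] r //= v Xv; apply: IH; case: c; last exact: X0.
by rewrite X01; exact: X0.
Qed.

Let child_sub r w : X (child r w) `<=` X r `|` D r.
Proof.
elim: w r => [|c w IH] r v /=; first by left.
by move/IH; case: (facts r) => ? ? ? ? [? ?]; case: c; pointwise v.
Qed.

Let iterYD n r : Y (iter n c0 r) `<=` Y r `|` D r /\ D (iter n c0 r) `<=` D r.
Proof.
elim: n r => [|n IH] r; first by split; setp.
rewrite iterSr; case: (IH (c0 r)) => ? ?; case: (facts r) => ? ? ? ? [? ?].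
by split; setp.
Qed.

Let root_sub r : root r `<=` Y r `|` D r.
Proof. by move=> v [n]; exact: (iterYD n r).1. Qed.

Let cons_sub r n s : star_branch r (n :: s) `<=` D r.
Proof.
have sub t : forall r, star_branch r t `<=` Y r `|` D r.
  elim: t => [|m t IH] q; first exact: root_sub.
  move=> /= v /IH; case: (iterYD m q) => ? ?.
  by case: (facts (iter m c0 q)) => ? ? ? ? [? ?]; pointwise v.
move=> /= v /sub; case: (iterYD n r) => ? ?.
by case: (facts (iter n c0 r)) => ? ? ? ? [? ?]; pointwise v.
Qed.

Let branch_sub r s : star_branch r s `<=` Y r `|` D r.
Proof.
case: s => [|n s]; first exact: root_sub.
by move=> v /cons_sub; right.
Qed.

Let root_c0 r : root r `<=` root (c0 r).
Proof.
move=> v [[|n]]; first by exists 0; exact: Y0.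
by rewrite iterSr; exists n.
Qed.

Let branchS r n s : star_branch r (n.+1 :: s) = star_branch (c0 r) (n :: s).
Proof. by rewrite /star_branch iterSr. Qed.

Let branch0 r s : star_branch r (0 :: s) = star_branch (c1 r) s.
Proof. by []. Qed.

Let disj_root n : forall r s, disj (root r) (star_branch r (n :: s)).
Proof.
elim: n => [|n IH] r s v /root_c0 rv.
  rewrite branch0 => /branch_sub bv.
  by have rv' := root_sub rv; case: (five r) => *; pointwise v.
by rewrite branchS; exact: IH.
Qed.

Let disj_lt n : forall m r s t, (n < m)%N ->
  disj (star_branch r (n :: s)) (star_branch r (m :: t)).
Proof.
elim: n => [|n IH] [|m] r s t // nm v.
  rewrite branch0 branchS => /branch_sub ? /cons_sub ?.
  by case: (five r) => *; pointwise v.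
by rewrite !branchS; exact: IH.
Qed.

Let disj_branch s : forall r t, s <> t -> disj (star_branch r s) (star_branch r t).
Proof.
elim: s => [|n s IH] r [|m t] // st.
- exact: disj_root.
- by move=> v ? ?; exact: (@disj_root n r s v).
have [nm|mn|e] := ltngtP n m.
- exact: disj_lt.
- by move=> v ? ?; exact: (@disj_lt m n r t s mn v).
- by rewrite e; apply: IH => e'; apply: st; rewrite e e'.
Qed.

(** The descents to a piece of the apex and to the branch are followed in parallel; where they part,
    the disjointness of that split separates them. *)
Let disj_top r s : disj (top r) (star_branch r s).
Proof.
move=> v [w]; elim: w r s => [|c w IH] r s /= hX hB.
  have := branch_sub hB; case: (res r) => *; pointwise v.
case: s hB => [|[|n] s].
- move=> /root_c0; case: c hX => [/child_sub hX /root_sub hY|hX hY].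
    by move: hX; rewrite X01; case: (five r) => *; pointwise v.
  exact: (IH _ [::] hX hY).
- rewrite branch0; case: c hX => hX hY; first exact: IH hX hY.
  have := child_sub hX; have := branch_sub hY; case: (five r) => *; pointwise v.
- rewrite branchS; case: c hX => hX hY; last exact: IH hX hY.
  have := child_sub hX; have := cons_sub hY; rewrite X01.
  by case: (five r) => *; pointwise v.
Qed.

Let top_c0 r : top (c0 r) `<=` top r.
Proof. by move=> v [w hw]; exists (false :: w). Qed.

Let top_c1 r : top (c1 r) `<=` top r.
Proof. by move=> v [w hw]; exists (true :: w). Qed.

Let touch_top s : forall r, touches (top r) (star_branch r s).
Proof.
elim: s => [|n s IH] r.
  apply: (touches_sub (res_touch (res r))) => v ?; first by exists [::].
  by exists 0.
elim: n r => [|n IHn] r.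
  by rewrite branch0; apply: (touches_sub (IH (c1 r))) => //; exact: top_c1.
by rewrite branchS; apply: (touches_sub (IHn (c0 r))) => //; exact: top_c0.
Qed.

Let touch_branch s n : forall r, touches (star_branch r s) (star_branch r (rcons s n)).
Proof.
elim: s => [|m s IH] r /=; last exact: IH.
(* The split that starts the n-th child leaves the parent's terminal in its [c0]-half, which is n +
   1 steps down. *)
apply: (touches_sub (touch (iter n c0 r))) => v ?; first by exists n.+1.
by exists 0.
Qed.

Lemma star_tree (r : R) : exists B : option (seq nat) -> set G,
  [/\ forall i, (exists v, B i v) /\ cut_connected (B i),
      forall i j, i <> j -> disj (B i) (B j),
      forall s, touches (B None) (B (Some s)) &
      forall s n, touches (B (Some s)) (B (Some (rcons s n)))].
Proof.
exists (fun i => if i is Some s then star_branch r s else top r); split=> //.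
- move=> [s|].
    elim: s r => [|n s IH] r //=.
    have [[y Yy] _ _] := resY (res r); split; first by exists y, 0.
    apply: (cut_connected_bigcup (c := y)) => n; first by case: (resY (res (iter n c0 r))).
    by elim: n => //= n; exact: Y0.
  have [[x Xx] _ _] := resX (res r); split; first by exists x, [::].
  apply: (cut_connected_bigcup (c := x)) => w; first by case: (resX (res (child r w))).
  exact: X_child.
- move=> [s|] [t|] // ij; first by apply: disj_branch => e; apply: ij; rewrite e.
  by move=> v ? ?; apply: (@disj_top r s v).
Qed.

End StarTree.

(* The vertices of the halved Farey graph on the edge Low-High; the vertex
   Between s is the one inserted after the choices s of a half-interval, first
   choice first. *)
Inductive plabel := Low | High | Between of seq bool.

(** Translates the name of a vertex within a half-interval to its name in the whole; the midpoint is
    an end of both halves. *)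
Definition sublabel (c : bool) (u : plabel) : plabel :=
  match u with
  | Low => if c then Between [::] else Low
  | High => if c then High else Between [::]
  | Between s => Between (c :: s)
  end.

(** * Iterated path splits *)

Section PathTree.
Variables (G : sgraph) (R : Type) (X Y D : R -> set G) (child : bool -> R -> R).
Local Notation c0 := (child false).
Local Notation c1 := (child true).
Hypothesis res : forall r, resource (X r) (Y r) (D r).
Hypothesis X0 : forall r, X r `<=` X (c0 r).
Hypothesis Y1 : forall r, Y r `<=` Y (c1 r).
Hypothesis X1 : forall r, X (c1 r) = Y (c0 r).
Hypothesis five : forall r, five_disjoint (X r `|` (Y r `|` D r))
  (X (c0 r)) (Y (c1 r)) (Y (c0 r)) (D (c0 r)) (D (c1 r)).

Let facts r : [/\ X (c0 r) `<=` X r `|` D r, Y (c1 r) `<=` Y r `|` D r,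
  Y (c0 r) `<=` D r & forall c, D (child c r) `<=` D r].
Proof.
have := X0 (r := r); have := Y1 (r := r); case: (five r); case: (res r).
by move=> *; split; last case; setp.
Qed.

(** An end grows only in the half-interval next to it, hence along a single chain. The midpoint is
    an end of both halves and unites two chains, joined at [X (c1 r) = Y (c0 r)]. *)
Let low r : set G := [set v | exists n, X (iter n c0 r) v].
Let high r : set G := [set v | exists n, Y (iter n c1 r) v].
Fixpoint between r (s : seq bool) : set G :=
  if s is c :: s' then between (child c r) s' else high (c0 r) `|` low (c1 r).

Definition path_branch r (u : plabel) : set G :=
  match u with Low => low r | High => high r | Between s => between r s end.

Let low_sub r : low r `<=` X r `|` D r.
Proof.
move=> v [n]; elim: n r => [|n IH] r; first by left.
by rewrite iterSr => /IH; case: (facts r) => ? ? ? /(_ false) ?; pointwise v.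
Qed.

Let high_sub r : high r `<=` Y r `|` D r.
Proof.
move=> v [n]; elim: n r => [|n IH] r; first by left.
by rewrite iterSr => /IH; case: (facts r) => ? ? ? /(_ true) ?; pointwise v.
Qed.

Let between_sub s : forall r, between r s `<=` D r.
Proof.
elim: s => [|c s IH] r v /=; last by move/IH; case: (facts r) => ? ? ?; apply.
case: (facts r) => ? ? h hD; have ? := hD false; have {hD} ? := hD true.
by case=> [/high_sub|/low_sub]; rewrite ?X1; pointwise v.
Qed.

Let low_c0 r : low r `<=` low (c0 r).
Proof.
move=> v [[|n]]; first by exists 0; exact: X0.
by rewrite iterSr; exists n.
Qed.

Let high_c1 r : high r `<=` high (c1 r).
Proof.
move=> v [[|n]]; first by exists 0; exact: Y1.
by rewrite iterSr; exists n.
Qed.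

Lemma path_branch_child c r u : path_branch (child c r) u `<=` path_branch r (sublabel c u).
Proof.
case: c; case: u => [||s] //= v.
- by move=> [n hn]; exists n.+1; rewrite iterSr.
- by move=> [n hn]; exists n.+1; rewrite iterSr.
Qed.

Let low_high r : disj (low r) (high r).
Proof.
move=> v /low_c0/low_sub ? /high_c1/high_sub ?.
by case: (five r) => *; pointwise v.
Qed.

Let low_between s : forall r, disj (low r) (between r s).
Proof.
elim: s => [|[] s IH] r v /low_c0 lv /= bv.
- case: bv => [hv|/low_sub]; first exact: low_high lv hv.
  by have := low_sub lv; rewrite X1; case: (five r) => *; pointwise v.
- by have := low_sub lv; have := between_sub bv; case: (five r) => *; pointwise v.
- exact: IH lv bv.
Qed.

Let high_between s : forall r, disj (high r) (between r s).
Proof.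
elim: s => [|[] s IH] r v /high_c1 hv /= bv.
- case: bv => [/high_sub|lv]; last exact: low_high lv hv.
  by have := high_sub hv; case: (five r) => *; pointwise v.
- exact: IH hv bv.
- by have := high_sub hv; have := between_sub bv; case: (five r) => *; pointwise v.
Qed.

Let between_nil s c : forall r, disj (between r [::]) (between r (c :: s)).
Proof.
move=> r v /= h; case: c => bv.
- case: h => [/high_sub|lv]; last exact: low_between lv bv.
  by have := between_sub bv; case: (five r) => *; pointwise v.
- case: h => [hv|/low_sub]; first exact: high_between hv bv.
  by have := between_sub bv; rewrite X1; case: (five r) => *; pointwise v.
Qed.

Let between_disj s : forall r t, s <> t -> disj (between r s) (between r t).
Proof.
elim: s => [|c s IH] r [|d t] // st.
  by move=> v ? ?; apply: (@between_nil s c r v).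
have [e|cd] := eqVneq c d; first by rewrite e; apply: IH => e'; apply: st; rewrite e e'.
move=> v /= /between_sub h /between_sub h'.
by case: (five r) => *; case: c d cd h h' {st} => [] [] // _ h h'; pointwise v.
Qed.

Lemma path_branch_disj r u v : u <> v -> disj (path_branch r u) (path_branch r v).
Proof.
case: u v => [||s] [||t] uv w hu hv; try by case: uv.
- exact: low_high hu hv.
- exact: low_between hu hv.
- exact: low_high hv hu.
- exact: high_between hu hv.
- exact: low_between hv hu.
- exact: high_between hv hu.
- by apply: (@between_disj s r t _ w hu hv) => e; apply: uv; rewrite e.
Qed.

Let low_conn r x : X r x -> low r x /\ cut_connected (low r).
Proof.
move=> Xx; split; first by exists 0.
apply: (cut_connected_bigcup (c := x)) => n; first by case: (resX (res (iter n c0 r))).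
by elim: n => //= n; exact: X0.
Qed.

Let high_conn r y : Y r y -> high r y /\ cut_connected (high r).
Proof.
move=> Yy; split; first by exists 0.
apply: (cut_connected_bigcup (c := y)) => n; first by case: (resY (res (iter n c1 r))).
by elim: n => //= n; exact: Y1.
Qed.

Lemma path_branch_conn r u :
  (exists v, path_branch r u v) /\ cut_connected (path_branch r u).
Proof.
case: u => [||s] /=.
- by have [[x Xx] _ _] := resX (res r); have [? ?] := low_conn Xx; split=> //; exists x.
- by have [[y Yy] _ _] := resY (res r); have [? ?] := high_conn Yy; split=> //; exists y.
elim: s r => [|c s IH] r //=.
have [[y Yy] _ _] := resY (res (c0 r)); have [hy ch] := high_conn Yy.
have Xy : X (c1 r) y by rewrite X1.
have [ly cl] := low_conn Xy.
split; first by exists y; left.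
by apply: (cut_connectedU ch cl hy ly); left.
Qed.

Lemma path_branch_ends r : touches (path_branch r Low) (path_branch r High).
Proof. by apply: (touches_sub (res_touch (res r))) => v ?; exists 0. Qed.

End PathTree.

(** * The Farey graph *)

(* The place of a/b in the Stern-Brocot tree; n is fuel. *)
Fixpoint stern_brocot_rec (n a b : nat) : plabel :=
  if n is n'.+1 then
    if a == 0 then Low else if b == 0 then High
    else if b <= a then sublabel true (stern_brocot_rec n' (a - b) b)
    else sublabel false (stern_brocot_rec n' a (b - a))
  else Low.

Definition stern_brocot a b := stern_brocot_rec (a + b) a b.

Lemma stern_brocot_fuel n m a b : a + b <= n -> a + b <= m ->
  stern_brocot_rec n a b = stern_brocot_rec m a b.
Proof.
elim: n m a b => [|n IH] [|m] a b hn hm //=.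
- by have -> : a = 0 by lia.
- by have -> : a = 0 by lia.
have [//|a0] := eqVneq a 0; have [//|b0] := eqVneq b 0.
by case: leqP => ba; congr sublabel; apply: IH; lia.
Qed.

Lemma stern_brocot_ge a b : b <= a -> 0 < a ->
  stern_brocot a b = sublabel true (stern_brocot (a - b) b).
Proof.
move=> ba a0; rewrite /stern_brocot.
rewrite (@stern_brocot_fuel _ (a + b).+1); [|lia|lia].
have [->|b0] := posnP b; last first.
  rewrite /= ba (gtn_eqF a0) (gtn_eqF b0); congr sublabel.
  by apply: stern_brocot_fuel; lia.
by case: a a0 {ba} => //= a _; rewrite addn0 subn0.
Qed.

(** At a = b this rule and [stern_brocot_ge] agree, since the upper end of the lower half is the
    lower end of the upper half. *)
Lemma stern_brocot_le a b : a <= b -> 0 < b ->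
  stern_brocot a b = sublabel false (stern_brocot a (b - a)).
Proof.
move=> ab b0; have [->|a0] := posnP a.
  by rewrite /stern_brocot; case: b b0 {ab} => //= b _; rewrite ?subn0.
have [ba|ab'] := leqP b a.
  have <- : a = b by lia.
  rewrite (stern_brocot_ge (leqnn a) a0) subnn.
  by rewrite /stern_brocot; case: a a0 {ab ba} => //= a _; rewrite addn0.
rewrite {1}/stern_brocot (@stern_brocot_fuel _ (a + b).+1); [|lia|lia].
rewrite /= leqNgt ab' (gtn_eqF a0) (gtn_eqF b0) /=; congr sublabel.
by rewrite /stern_brocot; apply: stern_brocot_fuel; lia.
Qed.

(** The fraction at a label: the two choices act as x -> x + 1 and x -> x / (x + 1), which map
    [0, oo] onto [1, oo] and [0, 1]. *)
Fixpoint between_value (s : seq bool) : nat * nat :=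
  if s is c :: s' then
    let: (a, b) := between_value s' in if c then (a + b, b) else (a, a + b)
  else (1, 1).

Definition label_value (u : plabel) : nat * nat :=
  match u with Low => (0, 1) | High => (1, 0) | Between s => between_value s end.

Lemma label_value_sub c u : label_value (sublabel c u) =
  let: (a, b) := label_value u in if c then (a + b, b) else (a, a + b).
Proof. by case: u; case: c. Qed.

(** A left inverse on reduced fractions, from which distinct rationals get distinct labels. *)
Lemma stern_brocotK a b : coprime a b -> label_value (stern_brocot a b) = (a, b).
Proof.
have [n] := ubnP (a + b); elim: n a b => // n IH a b abn cop.
have [a0|a0] := posnP a.
  by move: cop; rewrite a0 /coprime gcd0n => /eqP ->.
have [b0|b0] := posnP b.
  by move: cop; rewrite b0 /coprime gcdn0 => /eqP ->.
have [ba|/ltnW ab] := leqP b a.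
  rewrite stern_brocot_ge // label_value_sub IH ?subnK //; first by lia.
  by move: cop; rewrite -{1}(subnK ba) /coprime gcdnC gcdnDr gcdnC.
rewrite stern_brocot_le // label_value_sub IH ?subnKC //; first by lia.
by move: cop; rewrite -{1}(subnKC ab) /coprime gcdnDl.
Qed.

Definition rat_num (q : rat) : nat := `|numq q|%N.
Definition rat_den (q : rat) : nat := `|denq q|%N.

(** With [Low] at 0 and [High] at infinity, q >= 0 is placed at q + 1 and q < 0 at 1 / (1 - q); thus
    0 is placed at the midpoint 1. *)
Definition rat_label (q : rat) : plabel :=
  if (0 <= numq q)%R then sublabel true (stern_brocot (rat_num q) (rat_den q))
  else sublabel false (stern_brocot (rat_den q) (rat_num q)).

Lemma rat_den_gt0 q : 0 < rat_den q.
Proof. by rewrite /rat_den absz_gt0 denq_neq0. Qed.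

Lemma numqE q : (numq q = if 0 <= numq q then (rat_num q)%:Z else - (rat_num q)%:Z)%R.
Proof. by rewrite /rat_num; case: ifP => h; lia. Qed.

Lemma denqE q : (denq q = (rat_den q)%:Z)%R.
Proof. by rewrite /rat_den; have := denq_gt0 q; lia. Qed.

Lemma rat_label_value q : label_value (rat_label q) =
  if (0 <= numq q)%R then (rat_num q + rat_den q, rat_den q)
  else (rat_den q, rat_den q + rat_num q).
Proof.
rewrite /rat_label; case: ifP => _; rewrite label_value_sub stern_brocotK //.
  exact: coprime_num_den.
by rewrite coprime_sym; exact: coprime_num_den.
Qed.

Lemma rat_label_inj : injective rat_label.
Proof.
move=> p q /(congr1 label_value); rewrite !rat_label_value => h.
have := numqE p; have := numqE q; have := denqE p; have := denqE q.
have := rat_den_gt0 p; have := rat_den_gt0 q.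
move=> ? ? dq dp nq np.
have [] : numq p = numq q /\ denq p = denq q.
  by move: h nq np; do 2 case: ifP => ?; case=> *; split; lia.
by move=> en ed; rewrite -(divq_num_den p) -(divq_num_den q) en ed.
Qed.

Lemma rat_label_neq q : rat_label q <> Low /\ rat_label q <> High.
Proof.
have := rat_den_gt0 q; have := numqE q => nq d0.
by split=> /(congr1 label_value); rewrite rat_label_value /=;
  move: nq; case: ifP => ? ?; case; lia.
Qed.

(** * The Farey graph as a minor of its halved form *)

Section FareyMinor.
Variables (G : sgraph) (R : Type) (child : bool -> R -> R).
Variable B : R -> plabel -> set G.
Hypothesis B_conn : forall r u, (exists v, B r u v) /\ cut_connected (B r u).
Hypothesis B_disj : forall r u v, u <> v -> disj (B r u) (B r v).
Hypothesis B_child : forall c r u, B (child c r) u `<=` B r (sublabel c u).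
Hypothesis B_ends : forall r, touches (B r Low) (B r High).

Lemma touches_child c r u v : touches (B (child c r) u) (B (child c r) v) ->
  touches (B r (sublabel c u)) (B r (sublabel c v)).
Proof. by move/touches_sub; apply; exact: B_child. Qed.

(** Farey neighbours on the same side of 1 descend together, with the determinant unchanged and a
    smaller sum; the descent ends at 1/0 and 0/1. *)
Lemma stern_brocot_touches r a b c d : a * d = b * c + 1 ->
  touches (B r (stern_brocot a b)) (B r (stern_brocot c d)).
Proof.
have [n] := ubnP (a + b + c + d); elim: n r a b c d => // n IH r a b c d hn e.
have a0 : 0 < a by case: a e {hn} => //; lia.
have d0 : 0 < d by case: d e {hn} => //; lia.
have [/andP [ba dc]|h1] := boolP ((b <= a) && (d <= c)).
  rewrite (stern_brocot_ge ba a0) (stern_brocot_ge dc); last by lia.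
  by apply: touches_child; apply: IH; nia.
have [/andP [ab cd]|h2] := boolP ((a <= b) && (c <= d)).
  rewrite (stern_brocot_le ab) ?(stern_brocot_le cd d0); last by lia.
  by apply: touches_child; apply: IH; nia.
have [b0 c0] : b = 0 /\ c = 0.
  have [ba|ab] := leqP b a; last first.
    have dc : d < c by move: h2; rewrite (ltnW ab) /=; lia.
    nia.
  have cd : c < d by move: h1; rewrite ba /=; lia.
  have ab : b < a by move: h2; rewrite (ltnW cd) andbT; lia.
  (* If 1 lies strictly between c/d and a/b, then ad - bc >= (b + 1)(c + 1) - bc = b + c + 1, which
     leaves only b = c = 0. *)
  have [b' e1] : exists k, a = b + 1 + k by exists (a - b - 1); lia.
  have [c' e2] : exists k, d = c + 1 + k by exists (d - c - 1); lia.
  nia.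
move: e; rewrite b0 c0 mul0n add0n => /eqP; rewrite muln_eq1 => /andP [/eqP -> /eqP ->].
exact/touchesC/B_ends.
Qed.

(* Contracting the edge Low-High glues the two halves along Between [::]; one
   half carries the positive and the other the negative rationals. *)
Let V r (x : option rat) : set G :=
  if x is Some q then B r (rat_label q) else B r Low `|` B r High.

Let rat_touches r p q : (farey_det (Some p) (Some q) = 1)%R ->
  touches (B r (rat_label p)) (B r (rat_label q)).
Proof.
have cq : (0 <= numq q)%R = false -> 0 < rat_num q by rewrite /rat_num; lia.
rewrite /farey_det /= (numqE p) (numqE q) (denqE p) (denqE q) /rat_label.
have := rat_den_gt0 p; have := rat_den_gt0 q; move: cq.
move: (rat_num p) (rat_num q) (rat_den p) (rat_den q) => a c b d cq d0 b0.
case: ifP => sp; case: ifP => sq e.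
- by apply: touches_child; apply: stern_brocot_touches; nia.
(* The only edge between rationals of which just one is negative joins 0 and -1. The label of 0 is
   the midpoint, read here as the upper end of the lower half. *)
- have c0 := cq sq.
  have cb : 0 < c * b by rewrite muln_gt0 c0.
  have ad0 : a * d = 0 by nia.
  have a0 : a = 0 by nia.
  have b1 : b = 1 by nia.
  have c1 : c = 1 by nia.
  rewrite a0 b1 c1 -[sublabel true (stern_brocot 0 1)]/(sublabel false (stern_brocot 1 0)).
  by apply: touches_child; apply: stern_brocot_touches; lia.
- nia.
- by apply: touches_child; apply: stern_brocot_touches; nia.
Qed.

(** The neighbours of infinity are the integers: those that are not negative are next to [High], the
    others next to [Low]. *)
Let rat_touches_ends r q : rat_den q = 1 ->
  touches (V r None) (B r (rat_label q)).
Proof.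
move=> d1; rewrite /rat_label d1; case: ifP => _.
  apply: (@touches_sub _ (B r (sublabel true (stern_brocot 1 0)))
            (B r (sublabel true (stern_brocot (rat_num q) 1)))) => //.
    by apply: touches_child; apply: stern_brocot_touches; lia.
  by move=> v; right.
apply: (@touches_sub _ (B r (sublabel false (stern_brocot 0 1)))
          (B r (sublabel false (stern_brocot 1 (rat_num q))))) => //.
  by apply: touches_child; apply/touchesC/stern_brocot_touches; lia.
by move=> v; left.
Qed.

Lemma minor_farey (r : R) : minor farey G.
Proof.
exists (V r); split.
- case=> [q|]; first exact: (B_conn r (rat_label q)).1.
  by have [[v Bv] _] := B_conn r Low; exists v; left.
- case=> [q|]; apply: cut_connected_induced; first exact: (B_conn r _).2.
  have [a [b [? ? ?]]] := B_ends r.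
  by apply: (cut_connectedU (B_conn r Low).2 (B_conn r High).2); [eassumption..|right].
- have dV x y : x <> y -> disj (V r x) (V r y).
    case: x y => [p|] [q|] //= pq.
    + by apply: B_disj => /rat_label_inj e; apply: pq; rewrite e.
    + have [nl nh] := rat_label_neq p.
      by move=> v hv [|]; apply: B_disj hv.
    + have [nl nh] := rat_label_neq q.
      by move=> v [|] hv' hv; apply: B_disj hv hv'.
  move=> x y xy; apply/seteqP; split=> v // -[]; exact: dV.
- case=> [p|] [q|] //= /orP [] /eqP e.
  + exact: rat_touches.
  + apply: touchesC; apply: rat_touches.
    by rewrite -[RHS]opprK -e /farey_det opprB.
  + apply: touchesC; apply: rat_touches_ends.
    by move: e; rewrite /farey_det /= denqE; lia.
  + apply: touchesC; apply: rat_touches_ends.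
    by move: e; rewrite /farey_det /= denqE; lia.
  + by apply: rat_touches_ends; move: e; rewrite /farey_det /= denqE; lia.
  + by apply: rat_touches_ends; move: e; rewrite /farey_det /= denqE; lia.
Qed.

End FareyMinor.

(** * Embedding the tree *)

Section TreeEmbedding.
Variable T : sgraph.
Hypothesis T_tree : is_tree T.
Variable idx : T -> T -> nat.
Hypothesis idx_inj : forall x u v, adj x u -> adj x v -> idx x u = idx x v -> u = v.
Variable r : T.

Let walk v n := `[< exists p : seq T, [/\ path (@adj T) r p, last r p = v & size p = n] >].

Let walk_ex v : exists n, walk v n.
Proof.
have [_ conn _] := T_tree; have [p [pp lp]] := conn r v.
by exists (size p); apply/asboolP; exists p.
Qed.

Let dist v : nat := ex_minn (walk_ex v).

Let dist_walk v : exists p : seq T, [/\ path (@adj T) r p, last r p = v & size p = dist v].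
Proof. by rewrite /dist; case: ex_minnP => n /asboolP. Qed.

Let dist_le v p : path (@adj T) r p -> last r p = v -> dist v <= size p.
Proof.
move=> pp lp; rewrite /dist; case: ex_minnP => n _; apply.
by apply/asboolP; exists p.
Qed.

Let dist_adj u v : adj u v -> dist v <= (dist u).+1.
Proof.
move=> uv; have [p [pp lp sp]] := dist_walk u.
by rewrite -sp -(size_rcons p v); apply: dist_le; rewrite ?last_rcons // rcons_path pp lp.
Qed.

Let dist0 v : dist v = 0 -> v = r.
Proof.
move=> e; have [p [_ lp sp]] := dist_walk v.
by move: sp; rewrite e => /size0nil p0; rewrite -lp p0.
Qed.

Let parent_ex v : v <> r -> exists u, adj u v /\ dist v = (dist u).+1.
Proof.
move=> vr; have [p [pp lp sp]] := dist_walk v.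
case/lastP: p pp lp sp => [_ e|p w]; first by case: vr.
rewrite rcons_path last_rcons size_rcons => /andP [pp uw] wv; rewrite {}wv in uw *.
move=> sp; exists (last r p); split=> //.
have := dist_adj uw; have := dist_le pp erefl; lia.
Qed.

Let avoids (v x y : {classic T}) := exists p : seq {classic T},
  [/\ path (@adj T) x p, last x p = y & v \notin x :: p].

(** From x towards the root the distance drops below that of [v] after one step, so the path cannot
    run through [v]. *)
Let avoids_root v : forall n x, dist x = n -> n <= dist v -> x <> v -> avoids v r x.
Proof.
move=> n; elim: n => [|n IH] x dx dv xv.
  have e := dist0 dx; exists [::]; split=> //.
  by rewrite inE; apply/eqP => e'; apply: xv; rewrite e e'.
have [u [ux e]] : exists u, adj u x /\ dist x = (dist u).+1.
  apply: parent_ex => e; have := @dist_le x [::] isT (esym e).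
  by rewrite dx.
have du : dist u = n by lia.
have uv : u <> v by move=> e'; move: dv; rewrite -e'; lia.
have [p [pp lp vp]] := IH u du (ltnW dv) uv.
exists (rcons p x); rewrite rcons_path last_rcons pp lp; split=> //.
rewrite -rcons_cons mem_rcons inE negb_or vp andbT.
by apply/eqP => e'; apply: xv.
Qed.

Let avoids_sym v x y : avoids v x y -> avoids v y x.
Proof.
move=> [p [pp lp vp]]; exists (rev (belast x p)); split.
- by rewrite -lp rev_path; under eq_path do rewrite adj_sym.
- by case: p lp {pp vp} => [//|z p] /= _; rewrite rev_cons last_rcons.
- rewrite inE -lp negb_or mem_rev; apply/andP; split.
    by apply: contra vp => /eqP ->; exact: mem_last.
  by apply: contra vp; exact: mem_belast.
Qed.

Let avoids_trans v x y z : avoids v x y -> avoids v y z -> avoids v x z.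
Proof.
move=> [p [pp lp vp]] [q [pq lq vq]]; exists (p ++ q); split.
- by rewrite cat_path pp lp.
- by rewrite last_cat lp.
- rewrite -cat_cons mem_cat negb_or vp /=.
  by apply: contra vq; rewrite inE orbC => ->.
Qed.

(** Two such neighbours are joined through the root by a path that avoids [v], and [v] closes it to
    a cycle. Allowing equality of distances also excludes edges within one level. *)
Let parent_uniq v u1 u2 : adj u1 v -> adj u2 v -> dist u1 <= dist v ->
  dist u2 <= dist v -> u1 = u2.
Proof.
move=> a1 a2 d1 d2; apply: contrapT => u12.
have neq u : adj u v -> u <> v by move=> uv e; move: uv; rewrite e adj_irr.
have [p [pp lp vp]] : avoids v u1 u2.
  apply: (@avoids_trans _ _ r); first apply: avoids_sym.
    exact: avoids_root erefl d1 (neq _ a1).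
  exact: avoids_root erefl d2 (neq _ a2).
have [_ _] := T_tree; apply.
case: (@shortenP {classic T} (@adj T) u1 p pp) lp => p' pp' up' sp' lp'.
exists (v :: u1 :: p'); split.
- by case: p' lp' {pp' up' sp'} => //= e; case: u12.
- by rewrite /= rcons_path pp' /= lp' a2 adj_sym a1.
- rewrite cons_uniq up' andbT; apply: contra vp.
  by rewrite !inE => /orP [->//|/sp' ->]; rewrite orbT.
Qed.

(** The root is its own dummy parent; [tree_code] does not consult it, as its fuel is the distance
    from the root. *)
Let parent v : T :=
  if pselect (v = r) is right vr then sval (cid (parent_ex vr)) else r.

Let parentP v : v <> r -> adj (parent v) v /\ dist v = (dist (parent v)).+1.
Proof. by move=> vr; rewrite /parent; case: pselect => // h; case: cid. Qed.

Fixpoint tree_code_rec n v : seq nat :=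
  if n is n'.+1 then rcons (tree_code_rec n' (parent v)) (idx (parent v) v)
  else [::].

Definition tree_code v := tree_code_rec (dist v) v.

Let distr : dist r = 0.
Proof. by have := @dist_le r [::] isT erefl; rewrite leqn0 => /eqP. Qed.

Lemma tree_code_inj : injective tree_code.
Proof.
have sz n v : size (tree_code_rec n v) = n.
  by elim: n v => //= n IH v; rewrite size_rcons IH.
have inj n : forall u v, dist u = n -> dist v = n ->
    tree_code_rec n u = tree_code_rec n v -> u = v.
  elim: n => [|n IH] u v du dv /=; first by rewrite (dist0 du) (dist0 dv).
  have ur : u <> r by move=> e; move: du; rewrite e distr.
  have vr : v <> r by move=> e; move: dv; rewrite e distr.
  have [au eu] := parentP ur; have [av ev] := parentP vr.
  move=> /rcons_inj [e1 e2].
  have e : parent u = parent v by apply: IH e1; lia.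
  by rewrite e in au e2; exact: idx_inj au av e2.
move=> u v e; have := congr1 size e; rewrite !sz => d.
by apply: (inj (dist u)) => //; move: e; rewrite /tree_code d.
Qed.

Lemma tree_code_adj u v : adj u v ->
  (exists n, tree_code v = rcons (tree_code u) n) \/
  (exists n, tree_code u = rcons (tree_code v) n).
Proof.
have main x y : adj x y -> dist x <= dist y ->
    exists n, tree_code y = rcons (tree_code x) n.
  move=> xy dxy; have yr : y <> r.
    move=> e; move: dxy xy; rewrite e distr leqn0 => /eqP/dist0 ->.
    by rewrite adj_irr.
  have [ay ey] := parentP yr.
  have ex : x = parent y by apply: (parent_uniq xy ay dxy); lia.
  by exists (idx x y); rewrite /tree_code ey /= -ex.
move=> uv; have [le|/ltnW le] := leqP (dist u) (dist v); [left|right].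
  exact: main.
by apply: main => //; exact: adjC.
Qed.

End TreeEmbedding.

(** * Conclusion *)

Section Main.
Variable G : sgraph.
Implicit Types A C D P Q X Y Z U M : set G.

(* A minor model of the apex graph over the tree of finite sequences, with
   None as the apex and rcons s n as the n-th child of s. *)
Definition apex_model (B : option (seq nat) -> set G) :=
  [/\ forall i, (exists v, B i v) /\ cut_connected (B i),
      forall i j, i <> j -> disj (B i) (B j),
      forall s, touches (B None) (B (Some s)) &
      forall s n, touches (B (Some s)) (B (Some (rcons s n)))].

(** The codes embed [T] in the tree of finite sequences with edges between parents and children, and
    the branch sets are pulled back along this embedding. *)
Lemma apex_model_minor (T : sgraph) (B : option (seq nat) -> set G) : is_T_aleph0 T -> apex_model B ->
  minor (add_apex T) G.
Proof.
move=> [tree deg] [cB dB tB tB'].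
have [[r] _ _] := tree.
have idx_ex x : exists f : T -> nat, {in neighbors x &, injective f}.
  apply/countable_injP; have := deg x; rewrite card_eq_le => /andP [le _].
  exact: le.
have [idx hidx] := choice idx_ex.
have idx_inj x u v : adj x u -> adj x v -> idx x u = idx x v -> u = v.
  by move=> xu xv; apply: hidx; apply: mem_set.
have code_inj := @tree_code_inj T tree idx idx_inj r.
have code_adj := @tree_code_adj T tree idx r.
pose V (x : add_apex T) : set G := B (omap (tree_code tree idx r) x).
exists V; split.
- by move=> x; have [[v ?] _] := cB (omap (tree_code tree idx r) x); exists v.
- by move=> x; apply: cut_connected_induced; exact: (cB _).2.
- move=> x y xy; apply/seteqP; split=> v // -[].
  apply: dB; case: x y xy => [x|] [y|] //= xy [] // /code_inj e.
  by apply: xy; rewrite e.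
- case=> [x|] [y|] //= xy.
  + have [[n e]|[n e]] := code_adj x y xy; rewrite /V /= e; first exact: tB'.
    by apply: touchesC; exact: tB'.
  + by apply: touchesC; exact: tB.
  + exact: tB.
Qed.

(* The resources reachable from (X0, Y0) by splitting off stars at X0: the
   second terminal stays linked to Y0 outside the resource. *)
Record anchored X0 Y0 U X Y D : Prop := Anchored {
  anch_res : resource X Y D;
  anchX : X0 `<=` X; anchXU : X `<=` U; anchDU : D `<=` U;
  anch_link : exists Y', [/\ fin_conn Y', Y `<=` Y', Y0 `<=` Y',
                             disj X Y' /\ disj D Y' & Y' `<=` U] }.

Lemma fin_connU_sub A A' C : fin_conn A -> fin_conn A' -> fin_conn C ->
  C `<=` A -> C `<=` A' -> fin_conn (A `|` A').
Proof.
move=> fA fB [[c Cc] _ _] sA sB.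
by apply: (fin_connU fA fB (sA c Cc) (sB c Cc)); left.
Qed.

(** In the second half [Z] replaces [Y]; its link to [Y0] runs over the edge to [Y'] and then along
    the old link. *)
Lemma anchored_star_step X0 Y0 U X Y D : anchored X0 Y0 U X Y D ->
  star_split X Y (X `|` (Y `|` D)) ->
  exists X' Y' Z D1 D2,
  [/\ anchored X0 Y0 U X' Y' D1, anchored X0 Y0 U X' Z D2,
      X `<=` X' /\ Y `<=` Y', five_disjoint (X `|` (Y `|` D)) X' Y' Z D1 D2 &
      touches Y' Z].
Proof.
move=> [[fX fY XY XD YD _ _] sX sXU sDU [L [fL YL Y0L [XL DL] LU]]].
move=> [X' [Y1 [Z1 [D1 [D2 [[fX' fY1 fZ1] sX' sY1 d [g1 g2 t]]]]]]].
case: d => d1 d2 d3 d4 d5 d6 d7 d8 d9 d10 s1 s2 s3 s4 s5.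
have [Y' [rY' sY' Y's]] := resource_growr fX' fY1 d1 d4 d5 g1.
have [Z [rZ sZ Zs]] := resource_growr fX' fZ1 d2 d7 d9 g2.
have [_ fY' _ _ _ _ _] := rY'; have [_ fZ _ _ _ _ _] := rZ.
have fYL : fin_conn (Y' `|` L) by apply: (fin_connU_sub fY' fL fY) => //; setp.
have tYZ : touches Y' Z by exact: touches_sub t sY' sZ.
exists X', Y', Z, (D1 `\` Y'), (D2 `\` Z); split=> //.
- split=> //; try setp; exists (Y' `|` L); split=> //; try setp.
  by split; setp.
- split=> //; try setp; exists (Z `|` (Y' `|` L)); split=> //; try setp.
    have [y [z [Yy Zz yz]]] := tYZ.
    by apply: (fin_connU (a := z) (b := y)) => //; [left|right; exact: adjC].
  by split; setp.
- by split=> //; setp.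
- by split; setp.
Qed.

(** The terminal [Y'] absorbs the link and so extends [Y0]. The link meets X + Y + D only within
    [Y], so it does not disturb the other pieces. *)
Lemma anchored_path_split X0 Y0 U X Y D : anchored X0 Y0 U X Y D ->
  path_split X Y (X `|` (Y `|` D)) -> path_split X0 Y0 U.
Proof.
move=> [[fX fY XY XD YD _ _] sX sXU sDU [L [fL YL Y0L [XL DL] LU]]].
move=> [X' [Y' [Z [D1 [D2 [[fX' fY' fZ] sX' sY' d [g1 g2]]]]]]].
case: d => d1 d2 d3 d4 d5 d6 d7 d8 d9 d10 s1 s2 s3 s4 s5.
exists X', (Y' `|` L), Z, D1, (D2 `\` (Y' `|` L)); split=> //; try setp.
- by split=> //; apply: (fin_connU_sub fY' fL fY).
- by split; setp.
- by split=> //; apply: (good_grow g2) => v; left.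
Qed.

Lemma anchored_star_split_swap X0 Y0 U X Y D : anchored X0 Y0 U X Y D ->
  star_split Y X (X `|` (Y `|` D)) -> star_split Y0 X0 U.
Proof.
move=> [[fX fY XY XD YD _ _] sX sXU sDU [L [fL YL Y0L [XL DL] LU]]].
move=> [Y' [X' [Z [D1 [D2 [[fY' fX' fZ] sY' sX' d [g1 g2 t]]]]]]].
case: d => d1 d2 d3 d4 d5 d6 d7 d8 d9 d10 s1 s2 s3 s4 s5.
exists (Y' `|` L), X', Z, (D1 `\` (Y' `|` L)), (D2 `\` (Y' `|` L)); split=> //; try setp.
- by split=> //; apply: (fin_connU_sub fY' fL fY).
- by split; setp.
- by split=> //; apply: good_grow; try eassumption; move=> v; left.
Qed.

(** If every anchored configuration has a star split, choosing one for each yields the two child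
    maps of [star_tree]. *)
Lemma apex_model_or_no_star X0 Y0 D0 : resource X0 Y0 D0 ->
  (exists B, apex_model B) \/
  exists X Y D, anchored X0 Y0 (X0 `|` (Y0 `|` D0)) X Y D /\
                ~ star_split X Y (X `|` (Y `|` D)).
Proof.
move=> r0; set U := X0 `|` (Y0 `|` D0).
have a0 : anchored X0 Y0 U X0 Y0 D0.
  have [fX fY XY XD YD _ _] := r0.
  rewrite /U; split=> //; try setp; exists Y0; split=> //; try setp.
  by split; setp.
have [|h] := EM (exists X Y D, anchored X0 Y0 U X Y D /\
                ~ star_split X Y (X `|` (Y `|` D))); first by right.
left; pose R := {p : set G * set G * set G | anchored X0 Y0 U p.1.1 p.1.2 p.2}.
pose X (r : R) := (sval r).1.1; pose Y (r : R) := (sval r).1.2.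
pose D (r : R) := (sval r).2.
have step (r : R) : {c : R * R | [/\ X r `<=` X c.1, X c.2 = X c.1,
    Y r `<=` Y c.1, five_disjoint (X r `|` (Y r `|` D r))
      (X c.1) (Y c.1) (Y c.2) (D c.1) (D c.2) & touches (Y c.1) (Y c.2)]}.
  apply: cid; have ar : anchored X0 Y0 U (X r) (Y r) (D r) := svalP r.
  have sr : star_split (X r) (Y r) (X r `|` (Y r `|` D r)).
    by apply: contrapT => n; apply: h; exists (X r), (Y r), (D r).
  have [X' [Y' [Z [D1 [D2 [h1 h2 [? ?] ? ?]]]]]] := anchored_star_step ar sr.
  exists (exist _ (X', Y', D1) h1, exist _ (X', Z, D2) h2).
  by rewrite /X /Y /D /=.
have [||||||B hB] := @star_tree G R X Y D (fun r => (sval (step r)).1)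
   (fun r => (sval (step r)).2) _ _ _ _ _ _ (exist _ (X0, Y0, D0) a0).
- by move=> r; case: (svalP r).
- by move=> r; case: (svalP (step r)).
- by move=> r; case: (svalP (step r)).
- by move=> r; case: (svalP (step r)).
- by move=> r; case: (svalP (step r)).
- by move=> r; case: (svalP (step r)).
by exists B.
Qed.

Lemma unsplittable_apex_model X Y D : resource X Y D ->
  unsplittable X Y (X `|` (Y `|` D)) -> exists B, apex_model B.
Proof.
move=> [fX fY XY XD YD g _] uns.
have [|B [fB hB]] := unsplittable_clique fX fY XY XD YD _ g uns; first by setp.
have cB n : (exists v, B n v) /\ cut_connected (B n) by have [] := fB n.
have dB m n : m <> n -> disj (B m) (B n).
  have [mn|nm|//] := ltngtP m n => _; first exact: (hB m n mn).1.
  by move=> v ? ?; apply: ((hB n m nm).1 v).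
have tB m n : m <> n -> touches (B m) (B n).
  have [mn|nm|//] := ltngtP m n => _; first exact: (hB m n mn).2.
  by apply: touchesC; exact: (hB n m nm).2.
(* The infinite complete minor has a branch set for each vertex of the apex tree: 0 is reserved for
   the apex, and the sequences are shifted by one. *)
pose code (i : option (seq nat)) := if i is Some s then (pickle s).+1 else 0.
have code_inj : injective code.
  by case=> [s|] [t|] //= [] /(pcan_inj pickleK) ->.
exists (B \o code); split=> //=.
- by move=> i j ij; apply: dB => /code_inj.
- by move=> s; exact: tB.
- move=> s n; apply: tB => -[] /(pcan_inj pickleK) /(congr1 size).
  by rewrite size_rcons; lia.
Qed.

Lemma apex_model_of_no_path X Y D : resource X Y D ->
  ~ path_split X Y (X `|` (Y `|` D)) -> exists B, apex_model B.
Proof.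
move=> r0 nP0.
have [//|[X1 [Y1 [D1 [a1 nS1]]]]] := apex_model_or_no_star r0.
have nP1 : ~ path_split X1 Y1 (X1 `|` (Y1 `|` D1)).
  by move=> /(anchored_path_split a1).
(* In the second round [Y1] is the common terminal; the absence of star splits at [X1] survives by
   [anchored_star_split_swap]. *)
have [//|[X2 [Y2 [D2 [a2 nS2]]]]] := apex_model_or_no_star (resource_sym (anch_res a1)).
have e : Y1 `|` (X1 `|` D1) = X1 `|` (Y1 `|` D1) by rewrite setUCA.
rewrite e in a2; apply: (unsplittable_apex_model (anch_res a2)); split=> //.
- by move=> /(anchored_path_split a2)/path_split_sym.
- by move=> /(anchored_star_split_swap a2).
Qed.

Lemma farey_of_path_splits X0 Y0 D0 : resource X0 Y0 D0 ->
  (forall X Y D, resource X Y D -> path_split X Y (X `|` (Y `|` D))) ->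
  minor farey G.
Proof.
move=> r0 h; pose R := {p : set G * set G * set G | resource p.1.1 p.1.2 p.2}.
pose X (r : R) := (sval r).1.1; pose Y (r : R) := (sval r).1.2.
pose D (r : R) := (sval r).2.
have step (r : R) : {c : bool -> R | [/\ X r `<=` X (c false), Y r `<=` Y (c true),
    X (c true) = Y (c false) & five_disjoint (X r `|` (Y r `|` D r))
      (X (c false)) (Y (c true)) (Y (c false)) (D (c false)) (D (c true))]}.
  apply: cid; have rr : resource (X r) (Y r) (D r) := svalP r.
  have [X1 [Y1 [Z [D1 [D2 [[fX1 fY1 fZ] sX1 sY1 d [g1 g2]]]]]]] := h _ _ _ rr.
  case: d => d1 d2 d3 d4 d5 d6 d7 d8 d9 d10 s1 s2 s3 s4 s5.
  (* Only the outer terminals grow until they touch [Z], which must remain the same terminal in both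
     halves. *)
  have [X' [rX' sX' X's]] := resource_growl fX1 fZ d2 d4 d6 g1.
  have d3' : disj Z Y1 by setp.
  have [Y' [rY' sY' Y's]] := resource_growr fZ fY1 d3' d9 d8 (good_sym g2).
  exists (fun b => if b then exist _ (Z, Y', D2 `\` Y') rY'
                   else exist _ (X', Z, D1 `\` X') rX').
  by rewrite /X /Y /D /=; split=> //; [setp|setp|split; setp].
pose child c r := sval (step r) c.
have res r : resource (X r) (Y r) (D r) := svalP r.
have hX r : X r `<=` X (child false r) by case: (svalP (step r)).
have hY r : Y r `<=` Y (child true r) by case: (svalP (step r)).
have hXY r : X (child true r) = Y (child false r) by case: (svalP (step r)).
have h5 r : five_disjoint (X r `|` (Y r `|` D r)) (X (child false r))
  (Y (child true r)) (Y (child false r)) (D (child false r)) (D (child true r)).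
  by case: (svalP (step r)).
apply: (@minor_farey G R child (path_branch X Y child)).
- exact: path_branch_conn.
- exact: path_branch_disj.
- by move=> c r u; exact: path_branch_child.
- exact: path_branch_ends.
- exact: (exist _ (X0, Y0, D0) r0).
Qed.

Lemma infinitely_edge_connected_cut P a b : infinitely_edge_connected G ->
  P a -> ~ P b -> inf_cut P [set v | ~ P v].
Proof.
move=> [_ hG] Pa nPb [l hl].
have ab : a <> b by move=> e; apply: nPb; rewrite -e.
pose E (p : G * G) := [set e : set G | adj p.1 p.2 /\ e = [set p.1; p.2]].
pose F := [set e : set G | exists p, List.In p l /\ E p e].
apply: (hG a b ab); exists F; split.
- by move=> e [[u v] [_ [uv ->]]]; exists u, v.
- rewrite /F; elim: l {hl F} => [|p l IH].
    by apply: (sub_finite_set _ (finite_set0 (set G))) => e [? []].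
  apply: (sub_finite_set (B := [set [set p.1; p.2]] `|`
      [set e : set G | exists p, List.In p l /\ E p e])).
    by move=> e [q [[<-|ql] [? e']]]; [left|right; exists q].
  by rewrite finite_setU; split=> //; exact: finite_set1.
(* A path that avoids [F] never leaves [P], so it cannot end in [b]. *)
- move=> [p [pp lp]]; elim: p a Pa pp lp {ab} => [|c p IH] a Pa /=.
    by move=> _ e; rewrite -e in nPb.
  move=> /andP [/andP [ac nF] pp] lp; apply: IH pp lp.
  apply: contrapT => nPc; move/negP: nF; apply; apply/mem_set.
  by exists (a, c); split=> //; apply: hl.
Qed.

Lemma infinitely_edge_connected_resource : infinitely_edge_connected G ->
  exists X Y D, resource X Y D.
Proof.
move=> hG; have [[x [y xy]] _] := hG.
pose D := [set v | v <> x /\ v <> y].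
have g : good [set x] [set y] D.
  split=> [P a sP Pa|P sP].
    have nPx : ~ P x by move=> /sP [].
    apply: (inf_cut_sub (infinitely_edge_connected_cut hG Pa nPx)) => u v _ Pu nPv.
    left; split=> //; have [->|vx] := EM (v = x); first by right; left.
    have [->|vy] := EM (v = y); first by right; right.
    by left; split.
  have nPy : ~ ([set x] `|` P) y by move=> [/esym|/sP []].
  apply: (inf_cut_sub (@infinitely_edge_connected_cut ([set x] `|` P) x y hG _ nPy)).
    by left.
  move=> u v _ Pu nPv; left; split=> //.
  have [->|vy] := EM (v = y); first by left.
  right; split; first by split=> // e; apply: nPv; left.
  by move=> Pv; apply: nPv; right.
have [|||X' [r _ _]] := resource_growl (fin_conn1 x) (fin_conn1 y) _ _ _ g.
- by move=> v -> /xy.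
- by move=> v -> [].
- by move=> v -> [].
by exists X', [set y], (D `\` X').
Qed.

End Main.

Theorem theorem1 (G T : sgraph) (hG : infinitely_edge_connected G)
    (hT : is_T_aleph0 T) :
  minor farey G \/ minor (add_apex T) G.
Proof.
have [X0 [Y0 [D0 r0]]] := infinitely_edge_connected_resource hG.
have [h|h] := EM (forall X Y D : set G, resource X Y D ->
                    path_split X Y (X `|` (Y `|` D))).
  by left; exact: farey_of_path_splits r0 h.
right; have [X [Y [D [r nP]]]] : exists X Y D : set G, resource X Y D /\
    ~ path_split X Y (X `|` (Y `|` D)).
  apply: contrapT => n; apply: h => X Y D r; apply: contrapT => nP.
  by apply: n; exists X, Y, D.
have [B hB] := apex_model_of_no_path r nP.
exact: apex_model_minor hT hB.
Qed.
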